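(* Let $(M,J,g)$ be an integrable LCK manifold of real dimension $2n+2$, with Lee form $\theta$, anti-Lee form $\eta$, Lee vector field $U$ and anti-Lee vector field $V$. Then $$d\eta = \left(\frac{\delta\theta}{|\theta|^2}+n\right)\eta\wedge\theta,$$ $$[U,V] = \big(\delta\theta+n|\theta|^2\big)V + J\big(\operatorname{grad}|\theta|^2\big).$$
   Context: All manifolds are smooth of real dimension $2n+2$ with $n\ge 1$. A Hermitian manifold $(M,J,g)$ consists of a $(1,1)$-tensor field $J$ with $J^2=-\mathrm{Id}$ and vanishing Nijenhuis torsion, and a Riemannian metric $g$ with $g(JX,JY)=g(X,Y)$. Its fundamental $2$-form is $\Omega(X,Y)=g(X,JY)$. The codifferential is $\delta=-\sum_k i_{E_k}\nabla_{E_k}$ for a local orthonormal frame $(E_k)$ and the Levi-Civita connection $\nabla$. The anti-Lee $1$-form is $\eta=\frac1n\delta\Omega$ and the Lee $1$-form is $\theta(X)=\eta(JX)$; equivalently $\eta(X)=-\theta(JX)$. The manifold is locally conformal Kähler (LCK) if $d\Omega=\theta\wedge\Omega$ and $d\theta=0$. The Lee and anti-Lee vector fields $U,V$ are the metric duals of $\theta,\eta$: $\theta=g(U,\cdot)$, $\eta=g(V,\cdot)$ (so $V=JU$ and $|U|=|V|=|\theta|=|\eta|$). An LCK manifold is integrable if $V$ is nowhere zero and the distribution $V^\perp=\ker\eta$ is integrable. Conventions: $d\eta(X,Y)=X(\eta(Y))-Y(\eta(X))-\eta([X,Y])$, $(\alpha\wedge\beta)(X,Y)=\alpha(X)\beta(Y)-\alpha(Y)\beta(X)$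 for $1$-forms, and $(\theta\wedge\Omega)(X,Y,Z)=\theta(X)\Omega(Y,Z)+\theta(Y)\Omega(Z,X)+\theta(Z)\Omega(X,Y)$. The gradient is taken with respect to $g$. *)

(* Defs.v *)
From HB Require Import structures.
From mathcomp Require Import all_boot all_order all_algebra.
From mathcomp Require Import all_classical all_reals all_analysis.
From mathcomp Require Import ring.

Set Implicit Arguments.
Unset Strict Implicit.
Unset Printing Implicit Defensive.
Import Order.TTheory GRing.Theory Num.Theory.
Import numFieldNormedType.Exports.
Local Open Scope classical_set_scope.
Local Open Scope ring_scope.

(* On an open set W: partial derivatives up to order k exist and are
   continuous.  Values of f outside W play no role. *)
Fixpoint Ck (R : realType) (m k : nat) (W : set 'rV[R]_m) (f : 'rV[R]_m -> R)
    : Prop :=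
  (forall x, W x -> {for x, continuous f}) /\
  (if k is k'.+1 then forall i : 'I_m,
     (forall x, W x -> derivable f x (delta_mx 0 i)) /\
     Ck k' W (fun x => 'D_(delta_mx 0 i) f x)
   else True).

Definition smooth_on (R : realType) (m : nat) (W : set 'rV[R]_m)
  (f : 'rV[R]_m -> R) : Prop := forall k, Ck k W f.

Section SmoothOn.
Context (R : realType) (m : nat).
Implicit Types (W : set 'rV[R]_m) (f g : 'rV[R]_m -> R).

Lemma Ck_ext k W f g : open W -> (forall x, W x -> f x = g x) ->
  Ck k W f -> Ck k W g.
Proof.
move=> oW; have near_eq h1 h2 x : (forall y, W y -> h1 y = h2 y) -> W x ->
    \near x, h1 x = h2 x :> R.
  by move=> h12 Wx; apply: (@filterS _ _ _ W) => //; exact: open_nbhs_nbhs.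
have cont (h1 h2 : 'rV[R]_m -> R) : (forall y, W y -> h1 y = h2 y) ->
    (forall x, W x -> {for x, continuous h1}) ->
    forall x, W x -> {for x, continuous h2}.
  move=> h12 c1 x Wx; rewrite /prop_for /continuous_at -(h12 _ Wx).
  exact: cvg_trans (near_eq_cvg (near_eq _ _ _ h12 Wx)) (c1 _ Wx).
elim: k f g => [|k IH] f g fg [cf Hf]; split; try by [|exact: cont cf].
move=> i; have [df Cf] := Hf i; split=> [x Wx|].
  by apply: near_eq_derivable (df _ Wx); exact: near_eq.
by apply: IH Cf => x Wx; apply: near_eq_derive; exact: near_eq.
Qed.

Lemma Ck_pred k W f : Ck k.+1 W f -> Ck k W f.
Proof.
elim: k f => [|k IH] f [cf Hf]; first by split.
by split=> // i; have [df Cf] := Hf i; split=> //; exact: IH.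
Qed.

Lemma Ck_cst k W (a : R) : open W -> Ck k W (cst a).
Proof.
have cc (b : R) x : W x -> {for x, continuous (cst b : 'rV[R]_m -> R)}.
  by move=> _; exact: cst_continuous.
move=> oW; elim: k a => [|k IH] a; split=> //; try by move=> x; exact: cc.
move=> i; split=> [x _|]; first exact: derivable_cst.
by apply: (Ck_ext oW _ (IH 0)) => x _; rewrite derive_cst.
Qed.

Lemma CkB k W f g : open W -> Ck k W f -> Ck k W g -> Ck k W (f - g).
Proof.
move=> oW; elim: k f g => [|k IH] f g /= [cf Hf] [cg Hg].
  by split=> // x Wx; apply: continuousB; [exact: cf|exact: cg].
split=> [x Wx|i]; first by apply: continuousB; [exact: cf|exact: cg].
have [df Cf] := Hf i; have [dg Cg] := Hg i; split=> [x Wx|].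
  by apply: derivableB; [exact: df|exact: dg].
apply: Ck_ext (IH _ _ Cf Cg) => // x Wx.
by rewrite deriveB //; [exact: df|exact: dg].
Qed.

Lemma CkD k W f g : open W -> Ck k W f -> Ck k W g -> Ck k W (f + g).
Proof.
move=> oW Cf Cg; have C0 := Ck_cst k 0 oW.
rewrite -(opprK g) -[- g]add0r.
exact: CkB oW Cf (CkB oW C0 Cg).
Qed.

Lemma CkM k W f g : open W -> Ck k W f -> Ck k W g -> Ck k W (f * g).
Proof.
move=> oW; elim: k f g => [|k IH] f g Cf Cg.
  move: Cf Cg => [cf _] [cg _].
  by split=> // x Wx; apply: continuousM; [exact: cf|exact: cg].
have [Pf Pg] := (Ck_pred Cf, Ck_pred Cg).
move: Cf Cg => /= [cf Hf] [cg Hg].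
split=> [x Wx|i]; first by apply: continuousM; [exact: cf|exact: cg].
have [df Cf] := Hf i; have [dg Cg] := Hg i; split=> [x Wx|].
  by apply: derivableM; [exact: df|exact: dg].
apply: Ck_ext (CkD oW (IH _ _ Pf Cg) (IH _ _ Pg Cf)) => // x Wx.
by rewrite deriveM //; [exact: df|exact: dg].
Qed.

End SmoothOn.

(* A chart is a pair of total maps; only [chart_map] on [chart_dom] and
   [chart_inv] on the image [chart_cod] are meaningful. *)
Record chart (R : realType) (m : nat) (M : topologicalType) := Chart {
  chart_dom : set M;
  chart_map : M -> 'rV[R]_m;
  chart_inv : 'rV[R]_m -> M }.

Definition chart_cod (R : realType) (m : nat) (M : topologicalType)
  (c : chart R m M) : set 'rV[R]_m := chart_map c @` chart_dom c.

Definition is_chart (R : realType) (m : nat) (M : topologicalType)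
    (c : chart R m M) : Prop :=
  [/\ open (chart_dom c), open (chart_cod c),
      {in chart_dom c, cancel (chart_map c) (chart_inv c)},
      (forall p, chart_dom c p -> {for p, continuous (chart_map c)}) &
      (forall x, chart_cod c x -> {for x, continuous (chart_inv c)})].

Definition smooth_transition (R : realType) (m : nat) (M : topologicalType)
    (c c' : chart R m M) : Prop :=
  forall i : 'I_m,
    smooth_on (chart_map c @` (chart_dom c `&` chart_dom c'))
      (fun x => chart_map c' (chart_inv c x) 0 i).

Record manifold (R : realType) (m : nat) := Manifold {
  manifold_carrier :> topologicalType;
  atlas : set (chart R m manifold_carrier);
  manifold_hausdorff : hausdorff_space manifold_carrier;
  manifold_second_countable : @second_countable manifold_carrier;
  atlas_chart : forall c, atlas c -> is_chart c;
  atlas_cover : forall p, exists2 c, atlas c & chart_dom c p;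
  atlas_compatible : forall c c', atlas c -> atlas c' -> smooth_transition c c'
}.

Section SmoothFunctions.
Context (R : realType) (m : nat) (M : manifold R m).

Definition smooth (f : M -> R) : Prop :=
  forall c, atlas c -> smooth_on (chart_cod c) (f \o chart_inv c).

Definition smooth_pred : {pred M -> R} := fun f => `[< smooth f >].

Lemma smooth_subring_closed : subring_closed smooth_pred.
Proof.
have oc (c : chart R m M) : atlas c -> open (chart_cod c).
  by move=> /atlas_chart [].
split.
- by apply/asboolP => c /oc oW k; exact: Ck_cst.
- move=> f g /asboolP sf /asboolP sg; apply/asboolP => c Ac k.
  exact: CkB (oc _ Ac) (sf c Ac k) (sg c Ac k).
- move=> f g /asboolP sf /asboolP sg; apply/asboolP => c Ac k.
  exact: CkM (oc _ Ac) (sf c Ac k) (sg c Ac k).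
Qed.

HB.instance Definition _ :=
  GRing.isSubringClosed.Build (M -> R) smooth_pred smooth_subring_closed.

Lemma smooth_scaler_closed : GRing.scaler_closed (smooth_pred : {pred M -> R}).
Proof.
move=> a f /asboolP sf; apply/asboolP => c Ac k.
have [_ oW _ _ _] := atlas_chart Ac.
exact: CkM oW (Ck_cst k a oW) (sf c Ac k).
Qed.

HB.instance Definition _ :=
  GRing.isScaleClosed.Build R (M -> R) smooth_pred smooth_scaler_closed.

Record Cinf := MkCinf {
  Cinf_fun :> M -> R;
  Cinf_smooth : Cinf_fun \in smooth_pred }.

HB.instance Definition _ := [isSub for Cinf_fun].
HB.instance Definition _ := [Choice of Cinf by <:].
HB.instance Definition _ :=
  GRing.SubChoice_isSubComPzRing.Build _ _ Cinf smooth_subring_closed.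
HB.instance Definition _ := [SubZmodule_isSubLmodule of Cinf by <:].

Definition derivation (X : Cinf -> Cinf) : Prop :=
  (forall (a : R) (f g : Cinf), X (a *: f + g) = a *: X f + X g) /\
  (forall f g : Cinf, X (f * g) = X f * g + f * X g).

Definition derivation_pred : {pred Cinf -> Cinf^o} :=
  fun X => `[< derivation X >].

Lemma derivation_submod_closed : submod_closed derivation_pred.
Proof.
split.
  apply/asboolP; split=> [a f g|f g]; apply: val_inj; apply/funext => p /=.
    by rewrite !fctE /= scaler0 addr0.
  by rewrite !fctE /= mul0r mulr0 addr0.
move=> h X Y /asboolP [lX LX] /asboolP [lY LY]; apply/asboolP.
split=> [a f g|f g]; rewrite !fctE ?lX ?lY ?LX ?LY.
all: apply: val_inj; apply/funext => p /=.
  by rewrite !fctE /GRing.scale /=; ring.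
by rewrite !fctE; ring.
Qed.

HB.instance Definition _ :=
  GRing.isSubmodClosed.Build Cinf (Cinf -> Cinf^o) derivation_pred
    derivation_submod_closed.

(* Smooth vector fields, as derivations of the algebra of smooth functions. *)
Record vfield := MkVfield {
  vfield_fun :> Cinf -> Cinf^o;
  vfieldP : vfield_fun \in derivation_pred }.

HB.instance Definition _ := [isSub for vfield_fun].
HB.instance Definition _ := [Choice of vfield by <:].
HB.instance Definition _ := [SubChoice_isSubLmodule of vfield by <:].

Definition bracket_fun (X Y : vfield) : Cinf -> Cinf^o :=
  fun f => X (Y f) - Y (X f).

Lemma bracket_subproof (X Y : vfield) : bracket_fun X Y \in derivation_pred.
Proof.
have [[lX LX] [lY LY]] := (asboolP _ (vfieldP X), asboolP _ (vfieldP Y)).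
have aX f g : X (f + g) = X f + X g by have := lX 1 f g; rewrite !scale1r.
have aY f g : Y (f + g) = Y f + Y g by have := lY 1 f g; rewrite !scale1r.
apply/asboolP; split=> [a f g|f g]; rewrite /bracket_fun.
  by rewrite lX !lY lX scalerBr opprD addrACA.
rewrite LX LY aX aY !LX !LY; apply: val_inj; apply/funext => p /=.
by rewrite !fctE; ring.
Qed.

Definition bracket (X Y : vfield) : vfield := MkVfield (bracket_subproof X Y).

Definition tangent (X : vfield) (p : M) : Cinf -> R := fun f => X f p.

(* Tensor fields are Cinf-multilinear maps on vector fields. *)
Definition oneform := {linear vfield -> Cinf^o}.
Definition endo := {linear vfield -> vfield}.

Record riemannian_metric := RiemannianMetric {
  metric_fun :> vfield -> vfield -> Cinf;
  metric_linear : forall (f : Cinf) (X Y Z : vfield),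
    metric_fun (f *: X + Y) Z = f * metric_fun X Z + metric_fun Y Z;
  metric_sym : forall X Y, metric_fun X Y = metric_fun Y X;
  metric_ge0 : forall X (p : M), 0 <= metric_fun X X p;
  metric_eq0 : forall X (p : M), metric_fun X X p = 0 -> tangent X p = 0 }.

Definition nijenhuis (J : endo) (X Y : vfield) : vfield :=
  bracket (J X) (J Y) - J (bracket (J X) Y) - J (bracket X (J Y))
  + J (J (bracket X Y)).

Definition hermitian_structure (J : endo) (g : riemannian_metric) : Prop :=
  [/\ (forall X, J (J X) = - X),
      (forall X Y, nijenhuis J X Y = 0) &
      (forall X Y, g (J X) (J Y) = g X Y)].

Definition fundamental_form (J : endo) (g : riemannian_metric)
    (X Y : vfield) : Cinf :=
  g X (J Y).

Definition levi_civita (g : riemannian_metric)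
    (D : vfield -> vfield -> vfield) : Prop :=
  [/\ (forall (f : Cinf) X Y Z, D (f *: X + Y) Z = f *: D X Z + D Y Z),
      (forall X Y Z, D X (Y + Z) = D X Y + D X Z),
      (forall (X : vfield) (f : Cinf) Y,
         D X (f *: Y) = (X f : Cinf) *: Y + f *: D X Y),
      (forall X Y, D X Y - D Y X = bracket X Y) &
      (forall (X : vfield) Y Z, X (g Y Z) = g (D X Y) Z + g Y (D X Z))].

Definition ext_d1 (a : oneform) (X Y : vfield) : Cinf :=
  X (a Y) - Y (a X) - a (bracket X Y).

Definition ext_d2 (w : vfield -> vfield -> Cinf) (X Y Z : vfield) : Cinf :=
  X (w Y Z) + Y (w Z X) + Z (w X Y)
  - w (bracket X Y) Z - w (bracket Y Z) X - w (bracket Z X) Y.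

Definition wedge11 (a b : oneform) (X Y : vfield) : Cinf :=
  a X * b Y - a Y * b X.

Definition wedge12 (a : oneform) (w : vfield -> vfield -> Cinf)
    (X Y Z : vfield) : Cinf :=
  a X * w Y Z + a Y * w Z X + a Z * w X Y.

Definition orthonormal_near (g : riemannian_metric) (p : M)
    (E : 'I_m -> vfield) : Prop :=
  \forall q \near p, forall i j, g (E i) (E j) q = (i == j)%:R.

(* Some orthonormal frame near p: m orthonormal fields, m being the dimension,
   extended arbitrarily away from p.  The codifferentials at p do not depend
   on the choice. *)
Definition frame (g : riemannian_metric) (p : M) : 'I_m -> vfield :=
  xget (fun=> 0) [set E | orthonormal_near g p E].

Definition codiff1 (g : riemannian_metric) (D : vfield -> vfield -> vfield)
    (a : oneform) (p : M) : R :=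
  - \sum_(k < m) let E := frame g p k in (E (a E) - a (D E E) : Cinf) p.

Definition codiff2 (g : riemannian_metric) (D : vfield -> vfield -> vfield)
    (w : vfield -> vfield -> Cinf) (X : vfield) (p : M) : R :=
  - \sum_(k < m) let E := frame g p k in
      (E (w E X) - w (D E E) X - w E (D E X) : Cinf) p.

Definition anti_lee_form (n : nat) (J : endo) (g : riemannian_metric)
    (D : vfield -> vfield -> vfield) (eta : oneform) : Prop :=
  forall X p, eta X p = n%:R^-1 * codiff2 g D (fundamental_form J g) X p.

Definition lee_form (J : endo) (eta theta : oneform) : Prop :=
  forall X, theta X = eta (J X).

Definition lck (J : endo) (g : riemannian_metric) (theta : oneform) : Prop :=
  (forall X Y Z, ext_d2 (fundamental_form J g) X Y Z
                 = wedge12 theta (fundamental_form J g) X Y Z) /\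
  (forall X Y, ext_d1 theta X Y = 0).

Definition metric_dual (g : riemannian_metric) (a : oneform)
    (U : vfield) : Prop :=
  forall X, a X = g U X.

Definition gradient (g : riemannian_metric) (f : Cinf) (G : vfield) : Prop :=
  forall X : vfield, g G X = X f.

(* The differential at w of a parametrization F of a piece of M. *)
Definition param_diff (k : nat) (F : 'rV[R]_k -> M) (w v : 'rV[R]_k) :
    Cinf -> R :=
  fun f => 'D_v (fun x => f (F x)) w.

(* F restricted to W is an injective immersion whose tangent space at every
   point F w is the kernel of a there. *)
Definition integral_manifold (a : oneform) (k : nat) (W : set 'rV[R]_k)
    (F : 'rV[R]_k -> M) : Prop :=
  [/\ open W,
      {in W &, injective F},
      (forall w, W w -> {for w, continuous F}) /\
        (forall f : Cinf, smooth_on W (f \o F)),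
      (forall w, W w -> injective (param_diff F w)) &
      (forall w, W w -> range (param_diff F w)
         = [set tangent X (F w) | X in [set X : vfield | a X (F w) = 0]])].

(* The kernel of a nowhere zero 1-form has rank m - 1. *)
Definition kernel_integrable (a : oneform) : Prop :=
  forall p : M, exists (W : set 'rV[R]_m.-1) (F : 'rV[R]_m.-1 -> M),
    integral_manifold a W F /\ (F @` W) p.

Definition nowhere_zero (X : vfield) : Prop := forall p, tangent X p <> 0.

End SmoothFunctions.

(* Main.v *)
From HB Require Import structures.
Require Import Defs.
From mathcomp Require Import all_boot all_order all_algebra.
From mathcomp Require Import all_classical all_reals all_analysis.
From mathcomp Require Import ring lra.
Import Order.TTheory GRing.Theory Num.Theory.
Import numFieldNormedType.Exports.
Local Open Scope classical_set_scope.
Local Open Scope ring_scope.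
Set Implicit Arguments.
Unset Strict Implicit.
Unset Printing Implicit Defensive.

(** Let A(X,Y,Z) = g((nabla_X J)Y, Z), written [nablaJ], and let S(X,Y) =
g(nabla_X U, Y), written [hessU], which is symmetric because theta is closed.  Vanishing of the Nijenhuis tensor forces
A(JX,Y,Z) = - A(X,Y,JZ): the difference of the two sides is symmetric in X, Y
and skew in Y, Z, hence zero.  Together with d Omega = theta /\ Omega this
determines A ([nablaJ_lck]), and then, since eta = - theta o J,
   d eta (X,Y) = S(Y,JX) - S(X,JY) - (eta /\ theta)(X,Y) + |theta|^2 g(X,JY)
([d_eta]).  The right-hand side is J-invariant.

Integrability of ker eta makes d eta vanish on ker eta.  A vector H orthogonal
to U and V has JH orthogonal to them too, so d eta(H,U) = 0 and
d eta(H,V) = d eta(JH,JV) = - d eta(JH,U) = 0: only the pair U, V contributes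
and d eta is a multiple of eta /\ theta ([d_eta_wedge]).  Evaluating on the pairs
(E_k, J E_k) of an orthonormal frame and summing gives the factor
([d_eta_trace]).  The bracket [U,V] = nabla_U V - nabla_V U is then read off from
[d_eta] with X = U, because 2 S(U, .) = d|theta|^2 and (nabla_U J)U = 0
([bracket_UV]).

All of this happens at a point, whereas vector fields are derivations of the
algebra of global smooth functions and tensors are linear over that algebra.
Three facts bridge the gap.

- A field whose tangent vector at p is zero is g-orthogonal to everything at p
  ([null_vector]).  Bump functions exp(-1/t) extended by zero from a chart
  provide m fields X_i and m functions f_j with det(X_i f_j) nonzero at p.
  Conversely any m + 1 tangent vectors are dependent ([tangent_dim]), as ker eta
  is at each point the image of a linear map from R^(m-1).  If Z vanishes at p
  and d = det(X_i f_j), Cramer's rule writes d Z as a combination of the X_i with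
  coefficients vanishing at p, up to a field Z' that kills every f_j; by the
  dimension bound Z' is zero wherever d is not, so d Z' = 0 everywhere.

- An orthonormal family of m fields satisfies Parseval's identity
  ([parseval]), again by the dimension bound.  Such a family exists near every
  point, since otherwise the codifferential of Omega, hence eta, would vanish
  there ([frame_orthonormal]).

- Sections of ker eta are closed under bracket ([kernel_involutive]).  Along a
  parametrized leaf F two such fields are combinations of the coordinate
  derivatives of f o F with smooth coefficients; in the commutator the second
  derivatives cancel by Schwarz's theorem and what is left is tangent to the
  leaf. *)

(** * Functions of class C^1 on R^m *)

Section DirectionalDerivative.
Context (R : realType) (m : nat).
Implicit Types (W : set 'rV[R]_m) (f : 'rV[R]_m -> R) (x v : 'rV[R]_m).

Lemma is_derive_line f x v (t : R) : derivable f (x + t *: v) v ->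
  is_derive t 1 (fun s : R => f (x + s *: v)) ('D_v f (x + t *: v)).
Proof.
have E : (fun h : R => h^-1 *: (((fun s : R => f (x + s *: v)) \o shift t) h%:A
    - f (x + t *: v)))
  = (fun h => h^-1 *: ((f \o shift (x + t *: v)) (h *: v) - f (x + t *: v))).
  apply/funext => h /=; congr (_ *: (f _ - _)).
  by rewrite [h%:A]mulr1 scalerDl addrCA.
by move=> df; split; rewrite /derivable /derive E.
Qed.

Lemma is_deriveZ_dir f x v (k : R) : derivable f x v ->
  is_derive x (k *: v) f (k * 'D_v f x).
Proof.
move=> df; have df' : derivable f (x + 0 *: v) v by rewrite scale0r addr0.
have /@is_derive1_comp H :
    is_derive (k * 0 : R) 1 (fun s : R => f (x + s *: v)) ('D_v f x).
  by have := is_derive_line df'; rewrite mulr0 scale0r addr0.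
have dk : is_derive (0 : R) 1 (fun s : R => k * s) k.
  have := is_deriveZ k (is_derive_id (0 : R) 1).
  by rewrite [X in is_derive _ _ _ X]mulr1.
have {H dk} := H _ dk.
have -> : (fun s : R => f (x + s *: v)) \o (fun s : R => k * s)
   = (fun s => f (s *: (k *: v) + x)).
  by apply/funext => s /=; rewrite scalerA addrC [s * k]mulrC.
move=> [d1 d2]; split; first exact: (derivable1P f x (k *: v)).2.
rewrite mulrC -d2 /derive.
set g1 := fun h => h^-1 *: _; set g2 := fun h => h^-1 *: _.
suff -> : g1 = g2 by [].
by apply/funext => h; rewrite /g1 /g2 /= addr0 scale0r add0r [_%:A]mulr1.
Qed.

(** The segment is parametrized by [0,1] rather than by [0,k], so that k may
have any sign. *)
Lemma mvt_dir f x v (k : R) :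
  (forall t : R, 0 <= t <= 1 -> derivable f (x + (t * k) *: v) v) ->
  exists2 t : R, 0 <= t <= 1 &
    f (x + k *: v) - f x = k * 'D_v f (x + (t * k) *: v).
Proof.
move=> df.
pose F (s : R) := f (x + s *: (k *: v)).
have dF (t : R) : 0 <= t <= 1 -> is_derive t 1 F (k * 'D_v f (x + (t * k) *: v)).
  move=> /df d; have := is_deriveZ_dir k d; rewrite -scalerA => -[d1 <-].
  exact: is_derive_line.
have [||t t01] := @MVT_segment R F (fun t => k * 'D_v f (x + (t * k) *: v)) 0 1 ler01.
- by move=> t; rewrite in_itv /= => /andP[t0 t1]; apply: dF; rewrite !ltW.
- apply: derivable_within_continuous => t; rewrite in_itv /= => /dF d.
  exact: ex_derive.
move: t01; rewrite in_itv /= => t01.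
by rewrite subr0 mulr1 /F scale1r scale0r addr0; exists t.
Qed.


Lemma mx_norm_leP v (c : R) : 0 <= c ->
  (forall i, `|v 0 i| <= c) -> `|v| <= c.
Proof.
move=> c0 vc; rewrite [leLHS]mx_normrE; apply: bigmax_le => // -[i j] _ /=.
by rewrite (ord1 i).
Qed.

Lemma le_mx_norm v i : `|v 0 i| <= `|v|.
Proof. rewrite [leRHS]mx_normrE; exact: (le_bigmax _ _ (0, i)). Qed.

(** Go from x to x + h changing one coordinate at a time and apply the mean
value theorem on each leg.  The legs stay in the ball of radius |h| because
truncating h does not increase its sup norm. *)
Lemma C1_increment W f x (e : R) : open W -> Ck 1 W f -> W x -> 0 < e ->
  \forall h \near (0 : 'rV[R]_m),
    `|f (x + h) - f x - \sum_i h 0 i * 'D_(delta_mx 0 i) f x| <= e * `|h|.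
Proof.
move=> oW [_ Hf] Wx e0.
have e'0 : 0 < e / m.+1%:R by rewrite divr_gt0.
have nearD : \forall y \near x, forall i,
    `|'D_(delta_mx 0 i) f x - 'D_(delta_mx 0 i) f y| <= e / m.+1%:R.
  apply: (@filter_forall _ _ (fun i y =>
    `|'D_(delta_mx 0 i) f x - 'D_(delta_mx 0 i) f y| <= e / m.+1%:R)
    _ (nbhs_filter x)) => i.
  have [_ [ci _]] := Hf i.
  by move/cvgrPdist_le: (ci _ Wx) => /(_ _ e'0).
(* The tolerance e / (m+1) on each leg adds up to at most e. *)
have : \forall y \near x, W y /\
    forall i, `|'D_(delta_mx 0 i) f x - 'D_(delta_mx 0 i) f y| <= e / m.+1%:R.
  by apply: filterI nearD; exact: open_nbhs_nbhs.
rewrite (near_shift (0 : 'rV[R]_m)) subr0 => /nbhs_ballP [d /= d0 Hd].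
have {}Hd y : `|y| < d -> W (x + y) /\ forall i,
    `|'D_(delta_mx 0 i) f x - 'D_(delta_mx 0 i) f (x + y)| <= e / m.+1%:R.
  by move=> yd; rewrite addrC; apply: (Hd y); rewrite -ball_normE /= sub0r normrN.
apply/nbhs_ballP; exists d => //= h; rewrite -ball_normE /= sub0r normrN => hd.
pose tr k : 'rV[R]_m := \row_i if (i < k)%N then h 0 i else 0.
have tr0 : tr 0%N = 0 by apply/rowP => i; rewrite !mxE.
have trm : tr m = h by apply/rowP => i; rewrite !mxE ltn_ord.
have trS (k : 'I_m) : tr k.+1 = tr k + h 0 k *: delta_mx 0 k.
  apply/rowP => i; rewrite !mxE eqxx /= -val_eqE /= ltnS.
  case: ltngtP => [ik|ik|ik]; rewrite ?mulr0 ?mulr1 ?addr0 ?add0r //.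
  by congr (h _ _); exact: val_inj.
have trn (k : 'I_m) (t : R) : 0 <= t <= 1 ->
    `|tr k + (t * h 0 k) *: delta_mx 0 k| < d.
  move=> /andP[t0 t1]; apply: le_lt_trans hd; apply: mx_norm_leP => // i.
  rewrite !mxE eqxx /= -val_eqE /=; case: ltngtP => [ik|ik|ik].
  - by rewrite mulr0 addr0 le_mx_norm.
  - by rewrite mulr0 addr0 normr0.
  - rewrite mulr1 add0r normrM (ger0_norm t0).
    by apply: le_trans (le_mx_norm h k); rewrite ler_piMl.
have -> : f (x + h) - f x = \sum_(k < m) (f (x + tr k.+1) - f (x + tr k)).
  rewrite -(big_mkord xpredT (fun k => f (x + tr k.+1) - f (x + tr k))).
  by rewrite telescope_sumr // trm tr0 addr0.
rewrite -sumrB; apply: le_trans (ler_norm_sum _ _ _) _.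
have step (k : 'I_m) : `|f (x + tr k.+1) - f (x + tr k)
    - h 0 k * 'D_(delta_mx 0 k) f x| <= `|h| * (e / m.+1%:R).
  have [t t01|t t01] := @mvt_dir f (x + tr k) (delta_mx 0 k) (h 0 k).
    have [dk _] := Hf k; apply: dk.
    by rewrite -addrA; exact: (Hd _ (trn k t t01)).1.
  rewrite trS addrA => ->; rewrite -mulrBr normrM distrC -addrA.
  by apply: ler_pM => //; [exact: le_mx_norm|exact: (Hd _ (trn k t t01)).2].
apply: le_trans (ler_sum _ (fun k _ => step k)) _.
rewrite sumr_const card_ord -mulrnAr mulrC ler_wpM2r //.
rewrite -mulr_natr -mulrA ler_piMr ?(ltW e0) //.
by rewrite mulrC ler_pdivrMr // mul1r ler_nat.
Qed.

(** Smoothness is defined through coordinate derivatives alone; this gives back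
the chain rule and the linearity in v of the derivative along v. *)
Lemma C1_differentiable W f x : open W -> Ck 1 W f -> W x ->
  differentiable f x /\
  forall v, 'D_v f x = \sum_i v 0 i * 'D_(delta_mx 0 i) f x.
Proof.
move=> oW Cf Wx.
pose df v := \sum_i v 0 i * 'D_(delta_mx 0 i) f x.
have ldf : linear df.
  move=> a u v; rewrite /df scaler_sumr -big_split /=; apply: eq_bigr => i _.
  by rewrite !mxE /GRing.scale /=; ring.
pose L := GRing.isLinear.Build _ _ _ _ df ldf.
pose dfL : {linear 'rV[R]_m -> R} := HB.pack df L.
have cdf : continuous dfL.
  apply: (@continuous_big R^o _ +%R 0 xpredT _ _ _
    (fun i (u : 'rV[R]_m) => u 0 i * 'D_(delta_mx 0 i) f x)).
    exact: add_continuous.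
  by move=> i _ u; have /cvgMr_tmp := @coord_continuous R 1 m 0 i u; apply.
have E : f \o shift x = cst (f x) + dfL +o_ (0 : 'rV[R]_m) id.
  apply/eqaddoP => e e0; apply: filterS (C1_increment oW Cf Wx e0) => h.
  have -> : (f \o shift x - (cst (f x) + dfL)) h = f (x + h) - f x - df h.
    by rewrite -[LHS]/(f (h + x) - (f x + df h)) opprD addrA [h + x]addrC.
  by [].
have D : 'd f x = dfL :> ('rV[R]_m -> R) := diff_unique cdf E.
have df_x : differentiable f x by apply/diff_locallyP; rewrite D.
by split=> // v; rewrite deriveE // D.
Qed.

End DirectionalDerivative.

(** * Symmetry of second derivatives *)

Section Schwarz.
Context (R : realType) (m : nat).
Implicit Types (W : set 'rV[R]_m) (f : 'rV[R]_m -> R) (x y u v c : 'rV[R]_m).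

Lemma is_derive_shiftv f y u c : derivable f (y + c) u ->
  is_derive y u (fun z => f (z + c)) ('D_u f (y + c)).
Proof.
have E : (fun h : R => h^-1 *: (((fun z => f (z + c)) \o shift y) (h *: u) - f (y + c)))
       = (fun h => h^-1 *: ((f \o shift (y + c)) (h *: u) - f (y + c))).
  by apply/funext => h /=; rewrite addrA.
by move=> df; split; rewrite /derivable /derive E.
Qed.

(** The mean value theorem, applied in the direction u to the difference of f
along v and then in the direction v.  The left-hand side is symmetric in u, v;
the right-hand side is not, whence [schwarz]. *)
Lemma second_difference f x u v (s : R) :
  (forall a b : R, 0 <= a <= 1 -> 0 <= b <= 1 ->
     let y := x + (a * s) *: u + (b * s) *: v in
     derivable f y u /\ derivable ('D_u f) y v) ->
  exists a b : R, [/\ 0 <= a <= 1, 0 <= b <= 1 &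
    f (x + s *: u + s *: v) - f (x + s *: u) - (f (x + s *: v) - f x)
    = s * (s * 'D_v ('D_u f) (x + (a * s) *: u + (b * s) *: v))].
Proof.
move=> Hd; pose phi y := f (y + s *: v) - f y.
have I0 : 0 <= (0 : R) <= 1 by rewrite lexx ler01.
have I1 : 0 <= (1 : R) <= 1 by rewrite ler01 lexx.
have dphi (a : R) : 0 <= a <= 1 -> is_derive (x + (a * s) *: u) u phi
    ('D_u f (x + (a * s) *: u + s *: v) - 'D_u f (x + (a * s) *: u)).
  move=> a01.
  have [d1 _] := Hd a 1 a01 I1.
  have [d0 _] := Hd a 0 a01 I0.
  rewrite mul1r in d1; rewrite mul0r scale0r addr0 in d0.
  apply: is_deriveB; [exact: is_derive_shiftv|exact: derivableP].
have [|a a01] := @mvt_dir R m phi x u s.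
  by move=> t /dphi [].
have [_ ->] := dphi a a01; rewrite /phi => ->.
have [|b b01] := @mvt_dir R m ('D_u f) (x + (a * s) *: u) v s.
  by move=> t /(Hd a t a01) [].
by move=> ->; exists a, b.
Qed.

Lemma mx_norm_delta i : `|delta_mx 0 i : 'rV[R]_m| <= 1.
Proof.
apply: mx_norm_leP => // j; rewrite mxE eqxx /=.
by case: eqP => _; rewrite ?normr1 ?normr0.
Qed.

Lemma schwarz W f x i j : open W -> Ck 2 W f -> W x ->
  'D_(delta_mx 0 i) ('D_(delta_mx 0 j) f) x
  = 'D_(delta_mx 0 j) ('D_(delta_mx 0 i) f) x.
Proof.
move=> oW [_ Hf] Wx.
pose S k l := 'D_(delta_mx 0 k) ('D_(delta_mx 0 l) f).
have cS k l y : W y -> {for y, continuous (S k l)}.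
  by move=> Wy; have [_ [_ /(_ k) [_ [c _]]]] := Hf l; exact: c.
have dS k l y : W y -> derivable ('D_(delta_mx 0 l) f) y (delta_mx 0 k).
  by move=> Wy; have [_ [_ /(_ k) [c _]]] := Hf l; exact: c.
have df l y : W y -> derivable f y (delta_mx 0 l).
  by move=> Wy; have [c _] := Hf l; exact: c.
apply/eqP; rewrite -subr_eq0 -normr_le0; apply/ler_addgt0Pl => e e0.
rewrite addr0; have e2 : 0 < e / 2 by rewrite divr_gt0.
have nearS k l : \forall y \near x, `|S k l x - S k l y| <= e / 2.
  by move/cvgrPdist_le: (cS k l _ Wx) => /(_ _ e2).
have : \forall y \near x, [/\ W y, `|S i j x - S i j y| <= e / 2
    & `|S j i x - S j i y| <= e / 2].
  have nW : \forall y \near x, W y by exact: open_nbhs_nbhs.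
  by apply: filterS3 nW (nearS i j) (nearS j i) => y.
rewrite (near_shift (0 : 'rV[R]_m)) subr0 => /nbhs_ballP [d /= d0 Hd].
have {}Hd y : `|y| < d -> [/\ W (x + y), `|S i j x - S i j (x + y)| <= e / 2
    & `|S j i x - S j i (x + y)| <= e / 2].
  by move=> yd; rewrite addrC; apply: (Hd y); rewrite -ball_normE /= sub0r normrN.
(* Both legs have length s, so the parallelogram stays in the ball. *)
pose s := d / 3; have s0 : 0 < s by rewrite divr_gt0.
have small (a b : R) k l : 0 <= a <= 1 -> 0 <= b <= 1 ->
    `|(a * s) *: (delta_mx 0 k : 'rV[R]_m) + (b * s) *: delta_mx 0 l| < d.
  move=> /andP[a0 a1] /andP[b0 b1]; apply: le_lt_trans (ler_normD _ _) _.
  have B (t : R) n : 0 <= t -> t <= 1 -> `|(t * s) *: (delta_mx 0 n : 'rV[R]_m)| <= s.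
    move=> t0 t1; have ts0 := mulr_ge0 t0 (ltW s0).
    rewrite normrZ (ger0_norm ts0).
    apply: le_trans (_ : t * s <= s); last by rewrite ler_piMl // ltW.
    by rewrite ler_piMr // mx_norm_delta.
  have := B a k a0 a1; have := B b l b0 b1; rewrite /s; lra.
have [|a [b [a01 b01 E1]]] := @second_difference f x (delta_mx 0 j) (delta_mx 0 i) s.
  move=> a b a01 b01 /=; rewrite -addrA.
  by have [Wy _ _] := Hd _ (small a b j i a01 b01); split; [exact: df|exact: dS].
have [|a' [b' [a01' b01' E2]]] :=
  @second_difference f x (delta_mx 0 i) (delta_mx 0 j) s.
  move=> a' b' a01' b01' /=; rewrite -addrA.
  by have [Wy _ _] := Hd _ (small a' b' i j a01' b01'); split; [exact: df|exact: dS].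
have E : S i j (x + ((a * s) *: delta_mx 0 j + (b * s) *: delta_mx 0 i))
       = S j i (x + ((a' * s) *: delta_mx 0 i + (b' * s) *: delta_mx 0 j)).
  have EE := E1; rewrite [x + s *: _ + s *: _]addrAC in EE.
  have {}EE : s * (s * S i j (x + (a * s) *: delta_mx 0 j + (b * s) *: delta_mx 0 i))
      = s * (s * S j i (x + (a' * s) *: delta_mx 0 i + (b' * s) *: delta_mx 0 j)).
    have swap (p q r t : R) : p - q - (r - t) = p - r - (q - t) by ring.
    by apply: etrans (esym EE) _; rewrite swap; exact: E2.
  by move/(mulfI (lt0r_neq0 s0))/(mulfI (lt0r_neq0 s0)): EE; rewrite !addrA.
have [_ H1 _] := Hd _ (small a b j i a01 b01).
have [_ _ H2] := Hd _ (small a' b' i j a01' b01').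
rewrite -E distrC in H2.
rewrite -[leLHS]/(`|S i j x - S j i x|).
apply: le_trans (ler_distD
  (S i j (x + ((a * s) *: delta_mx 0 j + (b * s) *: delta_mx 0 i))) _ _) _.
rewrite [leRHS]splitr; exact: lerD H1 H2.
Qed.

End Schwarz.

(** * Calculus of smooth functions on open sets *)

Section CkCalculus.
Context (R : realType) (m : nat).
Implicit Types (W : set 'rV[R]_m) (f : 'rV[R]_m -> R).

Lemma Ck_local k W f :
  (forall x, W x -> exists2 N, N x & Ck k N f) -> Ck k W f.
Proof.
elim: k f => [|k IH] f loc; split=> //.
- by move=> x /loc [N Nx [c _]]; exact: c.
- by move=> x /loc [N Nx [c _]]; exact: c.
move=> i; split=> [x /loc [N Nx [_ /(_ i) [d _]]]|]; first exact: d.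
by apply: IH => x /loc [N Nx [_ /(_ i) [_ d]]]; exists N.
Qed.

Lemma smooth_on_local W f :
  (forall x, W x -> exists2 N, N x & smooth_on N f) -> smooth_on W f.
Proof. by move=> loc k; apply: Ck_local => x /loc [N Nx /(_ k)]; exists N. Qed.

Lemma smooth_on_sub W W' f : W' `<=` W -> smooth_on W f -> smooth_on W' f.
Proof. by move=> sub sf; apply: smooth_on_local => x /sub Wx; exists W. Qed.

Lemma smooth_on_ext W f h : open W -> (forall x, W x -> f x = h x) ->
  smooth_on W f -> smooth_on W h.
Proof. by move=> oW fh sf k; apply: Ck_ext (sf k). Qed.

Lemma smooth_on_derive W f i : smooth_on W f ->
  smooth_on W ('D_(delta_mx 0 i) f).
Proof. by move=> sf k; have [_ /(_ i) []] := sf k.+1. Qed.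

Lemma smooth_on_cst W (a : R) : open W -> smooth_on W (cst a).
Proof. by move=> oW k; exact: Ck_cst. Qed.

Lemma smooth_onM W f h : open W -> smooth_on W f -> smooth_on W h ->
  smooth_on W (fun x => f x * h x).
Proof. by move=> oW sf sh k; exact: CkM oW (sf k) (sh k). Qed.

Lemma smooth_onB W f h : open W -> smooth_on W f -> smooth_on W h ->
  smooth_on W (fun x => f x - h x).
Proof. by move=> oW sf sh k; exact: CkB oW (sf k) (sh k). Qed.

Lemma Ck_sum k W (I : Type) (r : seq I) (P : pred I) (F : I -> 'rV[R]_m -> R) :
  open W -> (forall i, P i -> Ck k W (F i)) ->
  Ck k W (fun x => \sum_(i <- r | P i) F i x).
Proof.
move=> oW CF; elim: r => [|i r IH].
  apply: (@Ck_ext _ _ _ _ (cst 0) _ oW) => [x _|]; first by rewrite big_nil.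
  exact: Ck_cst.
case Pi: (P i); last first.
  by apply: (Ck_ext oW _ IH) => x _; rewrite big_cons Pi.
by apply: (Ck_ext oW _ (CkD oW (CF i Pi) IH)) => x _; rewrite big_cons Pi.
Qed.

Lemma Ck_prod k W (I : Type) (r : seq I) (F : I -> 'rV[R]_m -> R) :
  open W -> (forall i, Ck k W (F i)) ->
  Ck k W (fun x => \prod_(i <- r) F i x).
Proof.
move=> oW CF; elim: r => [|i r IH].
  apply: (@Ck_ext _ _ _ _ (cst 1) _ oW) => [x _|]; first by rewrite big_nil.
  exact: Ck_cst.
by apply: (Ck_ext oW _ (CkM oW (CF i) IH)) => x _; rewrite big_cons.
Qed.

Lemma is_derive_coord (x : 'rV[R]_m) i j :
  is_derive x (delta_mx 0 j : 'rV[R]_m) (fun x : 'rV[R]_m => x 0 i)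
    ((i == j)%:R : R).
Proof.
have dc := @differentiable_coord R 1 m x 0 i.
have E : (fun h : R => h^-1 *: (((fun z : 'rV[R]_m => z 0 i) \o shift x)
     (h *: delta_mx 0 j) - x 0 i)) = (fun h : R => h^-1 *: (h * (i == j)%:R)).
  by apply/funext => h /=; rewrite !mxE eqxx addrK.
split; first exact: diff_derivable.
rewrite /derive E; apply/cvg_lim => //.
apply: cvg_near_cst; near=> h.
rewrite /GRing.scale /= mulrA mulVf ?mul1r //.
by near: h; exact: nbhs_dnbhs_neq.
Unshelve. all: by end_near. Qed.

Lemma smooth_on_coord W i : open W -> smooth_on W (fun x => x 0 i).
Proof.
move=> oW; case=> [|k].
  split=> // x _; exact: coord_continuous.
split=> [x _|j]; first exact: coord_continuous.
split=> [x _|]; first by have [] := is_derive_coord x i j.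
apply: (Ck_ext oW _ (Ck_cst k (i == j)%:R oW)) => x _.
by have [_ ->] := is_derive_coord x i j.
Qed.

End CkCalculus.

Section Composition.
Context (R : realType) (m n : nat).

(** By the chain rule the derivatives of f o phi are again sums of products of
functions of the same kind, so the induction is on the order, for all f at
once. *)
Lemma smooth_on_comp (W : set 'rV[R]_m) (O : set 'rV[R]_n)
    (phi : 'rV[R]_m -> 'rV[R]_n) (f : 'rV[R]_n -> R) :
  open W -> open O -> (forall x, W x -> O (phi x)) ->
  (forall j, smooth_on W (fun x => phi x 0 j)) -> smooth_on O f ->
  smooth_on W (f \o phi).
Proof.
move=> oW oO WO sphi.
have dphi x : W x -> differentiable phi x.
  move=> Wx.
  have -> : phi = \sum_(j < n) (fun x => phi x 0 j *: (delta_mx 0 j : 'rV[R]_n)).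
    by apply/funext => y; rewrite fct_sumE [LHS]row_sum_delta.
  apply: differentiable_sum => j.
  apply: differentiableZl.
  by have [] := C1_differentiable oW (sphi j 1%N) Wx.
have key h : smooth_on O h -> forall x, W x -> differentiable (h \o phi) x /\
    forall i, 'D_(delta_mx 0 i) (h \o phi) x
    = \sum_(j < n) 'D_(delta_mx 0 i) (fun x => phi x 0 j) x
         * ('D_(delta_mx 0 j) h (phi x)).
  move=> sh x Wx; have [dh Dh] := C1_differentiable oO (sh 1%N) (WO _ Wx).
  have dphx := dphi x Wx; split=> [|i]; first exact: differentiable_comp.
  rewrite deriveE; last exact: differentiable_comp.
  rewrite diff_comp //= -deriveE // -deriveE // Dh.
  apply: eq_bigr => j _; congr (_ * _).
  by rewrite derive_mx ?mxE //; exact: diff_derivable.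
move=> sf k; elim: k f sf => [|k IH] f sf.
  by split=> // x Wx; apply: differentiable_continuous; have [] := key f sf x Wx.
split=> [x Wx|i].
  by apply: differentiable_continuous; have [] := key f sf x Wx.
split=> [x Wx|]; first by apply: diff_derivable; have [] := key f sf x Wx.
have C : Ck k W (fun x => \sum_(j < n) 'D_(delta_mx 0 i) (fun x => phi x 0 j) x
         * (('D_(delta_mx 0 j) f \o phi) x)).
  apply: Ck_sum => // j _; apply: (CkM oW).
    exact: (smooth_on_derive i (sphi j)).
  exact: IH (smooth_on_derive j sf).
by apply: (Ck_ext oW _ C) => x Wx; have [_ ->] := key f sf x Wx.
Qed.

End Composition.

(** * Bump functions *)

Section FlatFunction.
Context (R : realType).

(** For n = 0 this is the usual flat function.  Its derivatives are combinations
of the functions with larger n, so the whole family is treated together. *)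
Definition flat (n : nat) (t : R) : R :=
  if 0 < t then t^-1 ^+ n * expR (- t^-1) else 0.

Lemma flat_gt0 n t : 0 < t -> 0 < flat n t.
Proof.
by move=> t0; rewrite /flat t0 mulr_gt0 ?expR_gt0 ?exprn_gt0 ?invr_gt0.
Qed.

Lemma flat_le0 n t : t <= 0 -> flat n t = 0.
Proof. by rewrite /flat leNgt => /negbTE ->. Qed.

(** With s = 1/t this is s^(n+2) / (n+2)! <= exp s.  The quadratic bound gives
differentiability at 0 with derivative 0. *)
Lemma flat_bound n (t : R) : `|flat n t| <= (n.+2)`!%:R * t ^+ 2.
Proof.
have [t0|t0] := ltP 0 t; last first.
  by rewrite flat_le0 // normr0 mulr_ge0 ?sqr_ge0.
rewrite (ger0_norm (ltW (flat_gt0 n t0))) /flat t0 /= expRN.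
have s0 : 0 < t^-1 by rewrite invr_gt0.
have F0 : 0 < (n.+2)`!%:R :> R by rewrite ltr0n fact_gt0.
rewrite ler_pdivrMr ?expR_gt0 //.
have := @expR_ge1Dxn R t^-1 n.+1 (ltW s0) => H.
have {}H : t^-1 ^+ n.+2 <= (n.+2)`!%:R * expR t^-1.
  rewrite -ler_pdivrMl // mulrC; apply: le_trans H; by rewrite lerDr.
have -> : t^-1 ^+ n = t ^+ 2 * t^-1 ^+ n.+2.
  rewrite -[n.+2]addn2 exprD mulrCA -exprMn mulfV ?gt_eqF //.
  by rewrite expr1n mulr1.
by rewrite [leRHS]mulrAC [leRHS]mulrC ler_wpM2l // sqr_ge0.
Qed.

Lemma is_derive_flat n (t : R) :
  is_derive t 1 (flat n) (flat n.+2 t - n%:R * flat n.+1 t).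
Proof.
have [t0|t0|<-] := ltgtP 0 t.
- have E : \forall s \near t, s^-1 ^+ n * expR (- s^-1) = flat n s.
    by near=> s; rewrite /flat ifT //; near: s; exact: lt_nbhsr.
  apply: near_eq_is_derive E _; rewrite /flat t0.
  have dV : is_derive t 1 (fun s : R => s^-1) (- t ^- 2).
    have := @is_deriveV R id t 1 1; rewrite gt_eqF // => /(_ isT _).
    by rewrite [X in is_derive _ _ _ X]mulr1; apply; exact: is_derive_id.
  have dN : is_derive t 1 (fun s : R => - s^-1) (t ^- 2).
    by have := is_deriveN dV; rewrite opprK.
  have dE := @is_derive1_comp R expR (fun s : R => - s^-1) t _ _
    (is_derive_expR (- t^-1)) dN.
  have dX := is_deriveX n dV.
  have D := is_deriveM dX dE; 
  have FE : (fun s : R => s^-1 ^+ n * expR (- s^-1))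
      = (fun s : R => s^-1) ^+ n * (expR \o (fun s : R => - s^-1)).
    by apply/funext => s; rewrite !fctE.
  rewrite FE; apply: (is_derive_eq D).
  rewrite !fctE /GRing.scale /=.
  have : t != 0 by rewrite gt_eqF.
  case: n {dX D FE} => [|n] tn0; first by rewrite !expr0 -exprVn; ring.
  by rewrite -!exprVn !exprS /=; ring.
- have E : \forall s \near t, cst 0 s = flat n s.
    near=> s; rewrite flat_le0 // ltW //; near: s; exact: lt_nbhsl.
  apply: near_eq_is_derive E _.
  rewrite !(flat_le0 _ (ltW t0)) mulr0 subrr; exact: is_derive_cst.
- rewrite !flat_le0 // mulr0 subrr.
  have L : (fun h : R => h^-1 *: ((flat n \o shift 0) (h *: 1) - flat n 0)) @ 0^'
      --> (0 : R).
    apply/cvgrPdist_le => e e0; near=> h.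
    have h0 : h != 0 by near: h; exact: nbhs_dnbhs_neq.
    rewrite sub0r normrN /= [h%:A]mulr1 addr0 [flat n 0]flat_le0 // subr0.
    rewrite normrM normfV ler_pdivrMl ?normr_gt0 //.
    apply: le_trans (flat_bound n h) _.
    have : `|h| <= e / (n.+2)`!%:R.
      near: h; apply: dnbhs0_le; by rewrite divr_gt0 // ltr0n fact_gt0.
    rewrite ler_pdivlMr ?ltr0n ?fact_gt0 // => H.
    by rewrite -[h ^+ 2]real_normK ?num_real // expr2 mulrCA ler_wpM2l // mulrC.
  by split; [apply/cvg_ex; exists 0|apply/cvg_lim].
Unshelve. all: by end_near. Qed.

End FlatFunction.

Section Bump.
Context (R : realType) (m : nat).

Lemma smooth_on_flat (W : set 'rV[R]_m) (q : 'rV[R]_m -> R) n :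
  open W -> smooth_on W q -> smooth_on W (flat n \o q).
Proof.
move=> oW sq.
have key j x : W x -> differentiable (flat j \o q) x /\
    forall i, 'D_(delta_mx 0 i) (flat j \o q) x
    = 'D_(delta_mx 0 i) q x * (flat j.+2 (q x) - j%:R * flat j.+1 (q x)).
  move=> Wx; have [dq _] := C1_differentiable oW (sq 1%N) Wx.
  have [dfl dflE] := is_derive_flat j (q x).
  have df : differentiable (flat j) (q x) by exact/derivable1_diffP.
  split=> [|i]; first exact: differentiable_comp.
  rewrite deriveE; last exact: differentiable_comp.
  by rewrite diff_comp // deriv1E //= derive1E dflE -deriveE.
move=> k; elim: k n => [|k IH] n.
  by split=> // x Wx; apply: differentiable_continuous; have [] := key n x Wx.
split=> [x Wx|i].
  by apply: differentiable_continuous; have [] := key n x Wx.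
split=> [x Wx|]; first by apply: diff_derivable; have [] := key n x Wx.
have C : Ck k W ('D_(delta_mx 0 i) q *
    ((flat n.+2 \o q) - cst n%:R * (flat n.+1 \o q))).
  apply: (CkM oW); first exact: (smooth_on_derive i sq).
  by apply: CkB => //; apply: CkM => //; exact: Ck_cst.
by apply: (Ck_ext oW _ C) => x Wx; have [_ ->] := key n x Wx.
Qed.

Definition sqdist (x0 x : 'rV[R]_m) : R := \sum_i (x 0 i - x0 0 i) ^+ 2.

Definition bump_function (x0 : 'rV[R]_m) (r : R) (x : 'rV[R]_m) : R :=
  flat 0 (r ^+ 2 - sqdist x0 x).

Lemma smooth_sqdist x0 : smooth_on setT (sqdist x0).
Proof.
move=> k; apply: Ck_sum => [|i _]; first exact: openT.
have C : Ck k setT (fun x : 'rV[R]_m => x 0 i - x0 0 i).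
  apply: CkB; [exact: openT| |exact: Ck_cst openT].
  exact: smooth_on_coord openT k.
by apply: (Ck_ext openT _ (CkM openT C C)) => x _; rewrite expr2.
Qed.

Lemma smooth_bump x0 r : smooth_on setT (bump_function x0 r).
Proof.
apply: smooth_on_flat; first exact: openT.
by move=> k; apply: CkB; [exact: openT|exact: Ck_cst openT|exact: smooth_sqdist].
Qed.

Lemma bump_gt0 x0 r : 0 < r -> 0 < bump_function x0 r x0.
Proof.
move=> r0; apply: flat_gt0; rewrite /sqdist big1 ?subr0 ?exprn_gt0 // => i _.
by rewrite subrr expr0n.
Qed.

Lemma bump_out x0 r x : 0 <= r -> r < `|x - x0| -> bump_function x0 r x = 0.
Proof.
move=> r0 rx; apply: flat_le0; rewrite subr_le0.
have [i ri] : exists i, r < `|(x - x0) 0 i|.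
  apply: contrapT => H; move: rx; apply/negP; rewrite -leNgt.
  apply: mx_norm_leP => // i; rewrite leNgt; apply/negP => ri; by apply: H; exists i.
rewrite /sqdist (bigD1 i) //=; apply: ler_wpDr.
  by apply: sumr_ge0 => j _; exact: sqr_ge0.
rewrite !mxE in ri; rewrite -[leRHS]real_normK ?num_real //.
by rewrite lerXn2r ?nnegrE // ltW.
Qed.

End Bump.

(** * Vector fields supported in a chart *)

Section Evaluation.
Context (R : realType) (m : nat) (M : manifold R m).
Implicit Types (f g : Cinf M) (X Y : vfield M) (p : M).

Lemma evD f g p : (f + g) p = f p + g p. Proof. by []. Qed.
Lemma evN f p : (- f) p = - f p. Proof. by []. Qed.
Lemma evB f g p : (f - g) p = f p - g p. Proof. by []. Qed.
Lemma evM f g p : (f * g) p = f p * g p. Proof. by []. Qed.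
Lemma evZ (a : R) f p : (a *: f) p = a * f p. Proof. by []. Qed.
Lemma ev1 p : (1 : Cinf M) p = 1. Proof. by []. Qed.

Lemma ev_sum (I : Type) (r : seq I) (P : pred I) (F : I -> Cinf M) p :
  (\sum_(i <- r | P i) F i) p = \sum_(i <- r | P i) F i p.
Proof. by elim/big_rec2: _ => // i x y _ <-; rewrite evD. Qed.

Lemma vevD X Y f p : (X + Y) f p = X f p + Y f p. Proof. by []. Qed.
Lemma vevB X Y f p : (X - Y) f p = X f p - Y f p. Proof. by []. Qed.
Lemma vevZ (h : Cinf M) X f p : (h *: X) f p = h p * X f p. Proof. by []. Qed.
Lemma vev0 f p : (0 : vfield M) f p = 0. Proof. by []. Qed.

Lemma vev_sum (I : Type) (r : seq I) (P : pred I) (F : I -> vfield M) f p :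
  (\sum_(i <- r | P i) F i) f p = \sum_(i <- r | P i) F i f p.
Proof. by elim/big_rec2: _ => // i x y _ <-; rewrite vevD. Qed.

End Evaluation.

Section ExtensionByZero.
Context (R : realType) (m : nat) (M : manifold R m).
Context (c : chart R m M) (Ac : atlas c) (p : M) (cp : chart_dom c p).

Lemma chartK (d : chart R m M) q : atlas d -> chart_dom d q ->
  chart_inv d (chart_map d q) = q.
Proof. by move=> /atlas_chart [_ _ K _ _] dq; apply: K; rewrite inE. Qed.

Lemma open_chart_preimage (d : chart R m M) (O : set M) : atlas d -> open O ->
  open [set x | chart_cod d x /\ O (chart_inv d x)].
Proof.
move=> /atlas_chart [_ oW _ _ ci] oO; rewrite openE => x [Wx Ox].
apply: filterI; first exact: open_nbhs_nbhs.
by apply: (ci x Wx); exact: open_nbhs_nbhs.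
Qed.

Definition extend (phi : 'rV[R]_m -> R) (q : M) : R :=
  if `[< chart_dom c q >] then phi (chart_map c q) else 0.

Lemma extendE phi q : chart_dom c q -> extend phi q = phi (chart_map c q).
Proof. by move=> cq; rewrite /extend asboolT. Qed.

(** Near a point of the chart domain the extension is phi read through a
transition map.  Any other point lies outside the image of the support of phi,
which is compact, hence closed as the manifold is Hausdorff, so the extension
vanishes near it. *)
Lemma smooth_extend (x0 : 'rV[R]_m) (r : R) phi :
  (forall x, `|x - x0| <= r -> chart_cod c x) ->
  smooth_on (chart_cod c) phi ->
  (forall x, chart_cod c x -> r < `|x - x0| -> phi x = 0) ->
  smooth (extend phi).
Proof.
move=> KW sphi phi0; pose K := [set x : 'rV[R]_m | `|x - x0| <= r].
have [_ oW _ _ ci] := atlas_chart Ac.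
have cK : compact K.
  apply: bounded_closed_compact.
    exists (`|x0| + r); split; first exact: num_real.
    move=> M' /ltW M'r x; rewrite /K /= => xr; apply: le_trans M'r.
    rewrite -[x](subrK x0) addrC; apply: le_trans (ler_normD _ _) _.
    by rewrite lerD2l.
  have -> : K = closed_ball_ (@Num.norm _ _) x0 r.
    by apply/seteqP; split=> x; rewrite /K /closed_ball_ /= distrC.
  exact: closed_closed_ball_.
have clK : closed (chart_inv c @` K).
  apply: compact_closed; first exact: manifold_hausdorff.
  apply: continuous_compact => //; apply: continuous_in_subspaceT => x.
  by rewrite inE => /KW; exact: ci.
move=> d Ad; apply: smooth_on_local => x dx.
have [cq|ncq] := pselect (chart_dom c (chart_inv d x)).
  pose N := [set y | chart_cod d y /\ chart_dom c (chart_inv d y)].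
  have oN : open N by apply: open_chart_preimage => //; have [] := atlas_chart Ac.
  exists N => //.
  have NE : N `<=` chart_map d @` (chart_dom d `&` chart_dom c).
    move=> y [[q dq <-]]; rewrite (chartK Ad dq) => cq'; by exists q.
  have S : smooth_on N (phi \o (chart_map c \o chart_inv d)).
    apply: (smooth_on_comp oN oW _ _ sphi).
      by move=> y [_ cy]; exists (chart_inv d y).
    move=> j; apply: (smooth_on_sub NE).
    exact: (atlas_compatible Ad Ac j).
  by apply: smooth_on_ext oN _ S => y [_ cy]; rewrite /= extendE.
pose N := [set y | chart_cod d y /\ (~` (chart_inv c @` K)) (chart_inv d y)].
have oN : open N by apply: open_chart_preimage => //; exact: closed_openC.
exists N.
  split=> // -[y Ky yE]; apply: ncq; rewrite -yE.
  by have [q cq <-] := KW _ Ky; rewrite chartK.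
apply: smooth_on_ext oN _ (smooth_on_cst 0 oN) => y [dy nK] /=.
rewrite /extend; case: asboolP => // cy; rewrite phi0 //.
  by exists (chart_inv d y).
rewrite ltNge; apply/negP => Ky; apply: nK.
by exists (chart_map c (chart_inv d y)) => //; rewrite chartK.
Qed.

Context (r : R) (r0 : 0 < r).
Let x0 := chart_map c p.
Context (KW : forall x, `|x - x0| <= r -> chart_cod c x).

Let oW : open (chart_cod c). Proof. by have [] := atlas_chart Ac. Qed.

Let smooth_bump_cod : smooth_on (chart_cod c) (bump_function x0 r).
Proof. exact: smooth_on_sub (fun _ _ => I) (@smooth_bump R m x0 r). Qed.

Lemma smooth_bump_extend phi : smooth_on (chart_cod c) phi ->
  extend (fun x => bump_function x0 r x * phi x) \in smooth_pred (M := M).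
Proof.
move=> sphi; apply/asboolP; apply: (smooth_extend KW).
  exact: smooth_onM.
by move=> x _ rx; rewrite (bump_out (ltW r0) rx) mul0r.
Qed.

Lemma smooth_in_chart (f : Cinf M) : smooth_on (chart_cod c) (f \o chart_inv c).
Proof. exact: (asboolP _ (Cinf_smooth f)) Ac. Qed.

(** The coordinate derivative, cut off so as to extend by zero. *)
Definition bump_partial (i : 'I_m) (f : Cinf M) : (Cinf M)^o :=
  MkCinf (smooth_bump_extend
    (smooth_on_derive i (smooth_in_chart f))).

Lemma chart_derivable (f : Cinf M) i x : chart_cod c x ->
  derivable (f \o chart_inv c) x (delta_mx 0 i).
Proof. by move=> Wx; have [_ /(_ i) [+ _]] := smooth_in_chart f 1%N; exact. Qed.

Lemma bump_partial_subproof i : bump_partial i \in derivation_pred (M := M).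
Proof.
apply/asboolP; split=> [a f g|f g]; apply: val_inj; apply/funext => q.
  rewrite -[RHS]/(a * bump_partial i f q + bump_partial i g q) /=.
  rewrite /extend; case: asboolP => [cq|_]; last by rewrite mulr0 addr0.
  have Wx : chart_cod c (chart_map c q) by exists q.
  have df := @chart_derivable f i _ Wx; have dg := @chart_derivable g i _ Wx.
  rewrite [X in _ * X](_ : _ = a * 'D_(delta_mx 0 i) (f \o chart_inv c) (chart_map c q)
    + 'D_(delta_mx 0 i) (g \o chart_inv c) (chart_map c q)); first by ring.
  rewrite -[LHS]/('D_(delta_mx 0 i) (a *: (f \o chart_inv c) + (g \o chart_inv c)) _).
  by rewrite deriveD ?deriveZ //; exact: derivableZ.
rewrite -[RHS]/(bump_partial i f q * g q + f q * bump_partial i g q) /=.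
rewrite /extend; case: asboolP => [cq|_]; last by rewrite mulr0 mul0r addr0.
have Wx : chart_cod c (chart_map c q) by exists q.
have df := @chart_derivable f i _ Wx; have dg := @chart_derivable g i _ Wx.
rewrite -[X in _ * X = _]/('D_(delta_mx 0 i)
  ((f \o chart_inv c) * (g \o chart_inv c)) _).
rewrite deriveM //= (chartK Ac cq) /GRing.scale /=; ring.
Qed.

Definition bump_field i : vfield M := MkVfield (bump_partial_subproof i).

(** Coordinates are centred at p so that the derivative of the cut-off factor
does not contribute at p. *)
Definition bump_coord (j : 'I_m) : Cinf M :=
  MkCinf (smooth_bump_extend
    (smooth_onB oW (smooth_on_coord j oW) (smooth_on_cst (x0 0 j) oW))).

Lemma bump_field_coord i j :
  bump_field i (bump_coord j) p = (bump_function x0 r x0) ^+ 2 * (i == j)%:R.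
Proof.
have Wx : chart_cod c x0 by exists p.
rewrite /= extendE // -/x0 expr2 -mulrA; congr (_ * _).
pose h := (bump_function x0 r * (fun x : 'rV[R]_m => x 0 j - x0 0 j)).
have -> : 'D_(delta_mx 0 i) (bump_coord j \o chart_inv c) x0
    = 'D_(delta_mx 0 i) h x0.
  apply: near_eq_derive; apply: (@filterS _ _ _ (chart_cod c));
    last exact: open_nbhs_nbhs.
  by move=> x [q cq <-] /=; rewrite chartK // extendE.
have db : derivable (bump_function x0 r) x0 (delta_mx 0 i).
  by have [_ /(_ i) [+ _]] := smooth_bump_cod 1%N; exact.
pose h2 := fun x : 'rV[R]_m => x 0 j - x0 0 j.
have [d2 D2] : is_derive x0 (delta_mx 0 i : 'rV[R]_m) h2 ((j == i)%:R : R).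
  have := is_deriveB (is_derive_coord x0 j i)
    (is_derive_cst (x0 0 j) x0 (delta_mx 0 i)).
  by rewrite subr0.
rewrite /h -/h2 deriveM // D2 {1}/h2 subrr scale0r addr0.
by rewrite eq_sym.
Qed.

End ExtensionByZero.

(** * Linear algebra over fields and over smooth functions *)

Section LinearAlgebra.
Context (F : fieldType).

Lemma exists_kernel_row a b (A : 'M[F]_(a, b)) : (b < a)%N ->
  exists2 c : 'rV[F]_a, c != 0 & c *m A = 0.
Proof.
move=> ba; have : kermx A != 0.
  rewrite kermx_eq0 /row_free neq_ltn; apply/orP; left.
  exact: leq_ltn_trans (rank_leq_col A) ba.
by case/rowV0Pn => c /sub_kermxP cA c0; exists c.
Qed.

(** Points are added one at a time: as long as the matrix does not have full
rank, some v annihilates the values seen so far, and a point separating v from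
0 raises the rank. *)
Lemma separating_family (T : Type) k (L : 'I_k -> T -> F) :
  (forall v : 'rV[F]_k, v != 0 -> exists t, \sum_i v 0 i * L i t != 0) ->
  exists t : 'I_k -> T, \det (\matrix_(i, j) L i (t j)) != 0.
Proof.
move=> sep.
have step r : (r <= k)%N -> exists t : 'I_r -> T,
    row_free (\matrix_(j < r, i < k) L i (t j)).
  elim: r => [_|r IH rk].
    have t0 : 'I_0 -> T by case.
    by exists t0; rewrite /row_free -leqn0 rank_leq_row.
  have [t] := IH (ltnW rk); set N := \matrix_(j, i) _ => freeN.
  have [v v0 vN] := exists_kernel_row N^T rk.
  have [t' vt'] := sep v v0; rewrite -addn1.
  exists (fun j => match fintype.split j with inl a => t a | inr _ => t' end).
  pose n : 'rV[F]_k := \row_i L i t'.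
  have -> : \matrix_(j < r + 1, i < k)
      L i (match fintype.split j with inl a => t a | inr _ => t' end) = col_mx N n.
    by apply/matrixP => j i; rewrite !mxE; case: fintype.split => a; rewrite mxE.
  have Nv : N *m v^T = 0 by rewrite -[N]trmxK -trmx_mul vN trmx0.
  have nv : n *m v^T != 0.
    apply: contraNneq vt' => /matrixP /(_ 0 0); rewrite !mxE => nv0.
    by rewrite -[X in _ == X]nv0; apply/eqP/eq_bigr => i _; rewrite !mxE mulrC.
  apply: inj_row_free => u; rewrite -[u]hsubmxK mul_row_col => uN.
  have /eqP un : rsubmx u *m (n *m v^T) = 0.
    have := congr1 (mulmx^~ v^T) uN.
    by rewrite mulmxDl mul0mx -!mulmxA Nv mulmx0 add0r.
  rewrite [rsubmx u]mx11_scalar mul_scalar_mx scaler_eq0 (negbTE nv) orbF in un.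
  move/eqP: un => u00.
  have u2 : rsubmx u = 0 by apply/matrixP => i j; rewrite !ord1 u00 mxE.
  move: uN; rewrite u2 mul0mx addr0 => /eqP; rewrite mulmx_free_eq0 // => /eqP ->.
  by rewrite row_mx0.
have [t freeN] := step k (leqnn k); exists t.
rewrite row_free_unit unitmxE unitfE -det_tr in freeN.
apply: contraNneq freeN => <-; apply/eqP; congr (\det _).
by apply/matrixP => i j; rewrite !mxE.
Qed.

End LinearAlgebra.

Section EvaluationDet.
Context (R : realType) (m : nat) (M : manifold R m).

Lemma ev_prod (I : Type) (r : seq I) (F : I -> Cinf M) p :
  (\prod_(i <- r) F i) p = \prod_(i <- r) F i p.
Proof. by elim/big_rec2: _ => // i x y _ <-; rewrite evM. Qed.

(** Evaluation at p is a ring morphism. *)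
Lemma ev_det k (A : 'M[Cinf M]_k) p :
  (\det A) p = \det (\matrix_(i, j) A i j p).
Proof.
rewrite ev_sum; apply: eq_bigr => s _; rewrite evM ev_prod; congr (_ * _).
  by case: (perm.odd_perm s); rewrite ?expr0 ?expr1.
by apply: eq_bigr => i _; rewrite mxE.
Qed.

Lemma Ck_det k n (W : set 'rV[R]_m) (A : 'rV[R]_m -> 'M[R]_n) : open W ->
  (forall i j, Ck k W (fun x => A x i j)) -> Ck k W (fun x => \det (A x)).
Proof.
move=> oW CA; apply: Ck_sum => // s _; apply: CkM => //; first exact: Ck_cst.
exact: Ck_prod.
Qed.

Lemma smooth_adj n (W : set 'rV[R]_m) (A : 'rV[R]_m -> 'M[R]_n) i j : open W ->
  (forall i j, smooth_on W (fun x => A x i j)) ->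
  smooth_on W (fun x => \adj (A x) i j).
Proof.
move=> oW CA k.
have C : Ck k W (fun x => (-1) ^+ (j + i) * \det (row' j (col' i (A x)))).
  apply: CkM => //; first exact: Ck_cst.
  apply: Ck_det => // a b.
  by apply: (Ck_ext oW _ (CA (lift j a) (lift i b) k)) => x _; rewrite !mxE.
by apply: (Ck_ext oW _ C) => x _; rewrite mxE.
Qed.

(** Lower bound m for the dimension of the tangent space at p. *)
Lemma chart_frame (p : M) : exists (X : 'I_m -> vfield M) (f : 'I_m -> Cinf M),
  \det (\matrix_(i, j) X i (f j) p) != 0.
Proof.
have [c Ac cp] := atlas_cover p.
have [_ oW _ _ _] := atlas_chart Ac.
have : nbhs (chart_map c p) (chart_cod c).
  by apply: open_nbhs_nbhs; split=> //; exists p.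
move=> /nbhs_ballP [e /= e0 He].
have r0 : 0 < e / 2 by rewrite divr_gt0.
have KW x : `|x - chart_map c p| <= e / 2 -> chart_cod c x.
  move=> xr; apply: He; rewrite -ball_normE /= distrC.
  by apply: le_lt_trans xr _; rewrite gtr_pMr // invf_lt1 // ltr1n.
exists (bump_field Ac r0 KW), (bump_coord Ac r0 KW).
have -> : \matrix_(i, j) bump_field Ac r0 KW i (bump_coord Ac r0 KW j) p
    = ((bump_function (chart_map c p) (e / 2) (chart_map c p)) ^+ 2)%:M.
  by apply/matrixP => i j; rewrite !mxE bump_field_coord // mulr_natr.
by rewrite det_scalar !expf_neq0 // gt_eqF // bump_gt0.
Qed.

End EvaluationDet.

(** * Pointwise meaning of the metric *)

Lemma vfield_ext (R : realType) (m : nat) (M : manifold R m) (X Y : vfield M) :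
  (forall f p, X f p = Y f p) -> X = Y.
Proof.
move=> XY; apply: val_inj; apply/funext => f; apply: val_inj; apply/funext => p.
exact: XY.
Qed.

Section MetricTensor.
Context (R : realType) (m : nat) (M : manifold R m) (g : riemannian_metric M).
Implicit Types (X Y Z : vfield M) (h : Cinf M) (p : M).

Lemma gDl X Y Z : g (X + Y) Z = g X Z + g Y Z.
Proof. by have := metric_linear g 1 X Y Z; rewrite scale1r mul1r. Qed.

Lemma g0l Z : g 0 Z = 0.
Proof. by have /eqP := gDl 0 0 Z; rewrite addr0 -subr_eq subrr eq_sym => /eqP. Qed.

Lemma gZl h X Z : g (h *: X) Z = h * g X Z.
Proof. by have := metric_linear g h X 0 Z; rewrite addr0 g0l addr0. Qed.

Lemma gNl X Z : g (- X) Z = - g X Z.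
Proof. by rewrite -scaleN1r gZl mulN1r. Qed.

Lemma gBl X Y Z : g (X - Y) Z = g X Z - g Y Z.
Proof. by rewrite gDl gNl. Qed.

Lemma g_suml (I : Type) (r : seq I) (P : pred I) (F : I -> vfield M) Z :
  g (\sum_(i <- r | P i) F i) Z = \sum_(i <- r | P i) g (F i) Z.
Proof. by elim/big_rec2: _ => [|i x y _ <-]; rewrite ?g0l ?gDl. Qed.

Lemma gDr X Y Z : g X (Y + Z) = g X Y + g X Z.
Proof. by rewrite !(Defs.metric_sym g X) gDl. Qed.

Lemma gNr X Z : g X (- Z) = - g X Z.
Proof. by rewrite !(Defs.metric_sym g X) gNl. Qed.

Lemma gBr X Y Z : g X (Y - Z) = g X Y - g X Z.
Proof. by rewrite gDr gNr. Qed.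

Lemma oneformZ (a : oneform M) h X : a (h *: X) = h * a X.
Proof. exact: linearZ. Qed.

End MetricTensor.

Section IntegrableHyperplanes.
Context (R : realType) (m : nat) (M : manifold R m).
Context (g : riemannian_metric M) (eta : oneform M) (V : vfield M).
Hypothesis m_gt0 : (0 < m)%N.
Hypothesis etaV : metric_dual g eta V.
Hypothesis V_neq0 : nowhere_zero V.
Hypothesis eta_int : kernel_integrable eta.
Implicit Types (X Y Z : vfield M) (f : Cinf M) (p : M).

Lemma etaVV_neq0 p : eta V p != 0.
Proof. by apply/eqP; rewrite etaV => /metric_eq0; exact: V_neq0. Qed.

Lemma param_diffE (W : set 'rV[R]_m.-1) (F : 'rV[R]_m.-1 -> M) f w v :
  open W -> (forall f : Cinf M, smooth_on W (f \o F)) -> W w ->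
  param_diff F w v f = \sum_i v 0 i * 'D_(delta_mx 0 i) (f \o F) w.
Proof.
move=> oW sF Ww; have [_ E] := C1_differentiable oW (sF f 1%N) Ww.
exact: E.
Qed.

(** Modulo V every tangent vector lies in ker eta, which is parametrized
linearly by R^(m-1); so m + 1 tangent vectors are described by rows of length m. *)
Lemma tangent_dim p (Y : 'I_m.+1 -> vfield M) :
  exists2 c : 'rV[R]_m.+1, c != 0 &
    forall f, \sum_i c 0 i * Y i f p = 0.
Proof.
have [W [F [[oW _ [_ sF] _ rF] [w Ww Fw]]]] := eta_int p.
pose Y' i := eta V *: Y i - eta (Y i) *: V.
have etaY' i : eta (Y' i) = 0 by rewrite linearB !oneformZ mulrC subrr.
have param i : exists v : 'rV[R]_m.-1, forall f,
    Y' i f p = \sum_j v 0 j * 'D_(delta_mx 0 j) (f \o F) w.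
  have : range (param_diff F w) (tangent (Y' i) (F w)).
    by rewrite rF //; exists (Y' i) => //=; rewrite etaY'.
  move=> [v _ vE]; exists v => f; rewrite -(param_diffE f v oW sF Ww) vE.
  by rewrite /tangent Fw.
have [v vE] := choice param.
pose A : 'M[R]_(m.+1, 1 + m.-1) := \matrix_i row_mx (eta (Y i) p)%:M (v i).
have [|c c0 cA] := @exists_kernel_row R _ _ A; first by rewrite add1n prednK.
exists c => // f; apply: (mulfI (etaVV_neq0 p)); rewrite mulr0 mulr_sumr.
have cA1 : \sum_i c 0 i * eta (Y i) p = 0.
  have /matrixP /(_ 0 (lshift _ 0)) := cA; rewrite !mxE => E0.
  rewrite -[RHS]E0.
  by apply: eq_bigr => i _; rewrite mxE row_mxEl mxE eqxx.
have cA2 j : \sum_i c 0 i * v i 0 j = 0.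
  have /matrixP /(_ 0 (rshift _ j)) := cA; rewrite !mxE => E0.
  rewrite -[RHS]E0.
  by apply: eq_bigr => i _; rewrite mxE row_mxEr.
transitivity (\sum_i (c 0 i * eta (Y i) p) * V f p + \sum_i c 0 i * Y' i f p).
  rewrite -big_split; apply: eq_bigr => i _.
  rewrite -[RHS]/(c 0 i * eta (Y i) p * V f p
    + c 0 i * (eta V p * Y i f p - eta (Y i) p * V f p)); ring.
rewrite -mulr_suml cA1 mul0r add0r.
under eq_bigr do rewrite vE mulr_sumr.
rewrite exchange_big /= big1 // => j _.
under eq_bigr do rewrite mulrA.
by rewrite -mulr_suml cA2 mul0r.
Qed.

(** Tensoriality of g.  Linearity over smooth functions is not enough by itself:
one must write Z as a combination of fields with coefficients vanishing at p. *)
Lemma null_vector Z p : (forall f, Z f p = 0) -> forall Y, g Z Y p = 0.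
Proof.
move=> Zp Y; have [X [f detp]] := chart_frame p.
pose A : 'M[Cinf M]_m := \matrix_(i, j) X i (f j).
pose z : 'rV[Cinf M]_m := \row_j Z (f j).
pose d := \det A; pose b := z *m \adj A.
have dE q : d q = \det (\matrix_(i, j) X i (f j) q).
  by rewrite ev_det; congr (\det _); apply/matrixP => i j; rewrite !mxE.
(* Cramer's rule: d Z and the sum of the b_i X_i agree on every f_j. *)
pose Z' := d *: Z - \sum_i b 0 i *: X i.
have bA j : \sum_i b 0 i * X i (f j) = d * Z (f j).
  have : b *m A = d *: z by rewrite -mulmxA mul_adj_mx mul_mx_scalar.
  move/matrixP/(_ 0 j); rewrite !mxE => <-.
  by apply: eq_bigr => i _; rewrite !mxE.
have Z'f j q : Z' (f j) q = 0.
  rewrite vevB vevZ vev_sum -evM -bA ev_sum.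
  by rewrite -sumrB big1 // => i _; exact: subrr.
have dZ' : d *: Z' = 0.
  apply: vfield_ext => h q; rewrite vevZ vev0.
  have [->|dq] := eqVneq (d q) 0; first by rewrite mul0r.
  (* At q, the X_i and Z' are m + 1 tangent vectors, and the X_i are independent. *)
  have [c c0 cE] := @tangent_dim q (fun i : 'I_m.+1 => oapp X Z' (unlift ord0 i)).
  have cX k : c 0 0 * Z' k q + \sum_i c 0 (lift ord0 i) * X i k q = 0.
    rewrite -[RHS](cE k) big_ord_recl unlift_none /=; congr (_ + _).
    by apply: eq_bigr => i _; rewrite liftK.
  pose c' : 'rV[R]_m := \row_i c 0 (lift ord0 i).
  have c'0 : c' = 0.
    apply/eqP; move: dq; rewrite dE => dq.
    have uA : (\matrix_(i, j) X i (f j) q) \in unitmx by rewrite unitmxE unitfE.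
    rewrite -[c'](mulmxK uA) (_ : c' *m _ = 0) ?mul0mx //.
    apply/matrixP => i j; rewrite ord1 !mxE -[RHS](cX (f j)) Z'f mulr0 add0r.
    by apply: eq_bigr => a _; rewrite !mxE.
  have c'i i : c 0 (lift ord0 i) = 0 by have /matrixP /(_ 0 i) := c'0; rewrite !mxE.
  have c00 : c 0 0 != 0.
    apply: contraNneq c0 => c00; apply/eqP/matrixP => i j; rewrite ord1 mxE.
    by have [k ->|->] := unliftP ord0 j.
  have := cX h; rewrite big1 ?addr0 => [|i _]; last by rewrite c'i mul0r.
  by move/eqP; rewrite mulf_eq0 (negbTE c00) => /eqP ->; rewrite mulr0.
have dp : d p != 0 by rewrite dE.
(* d Z' = 0 and d is nonzero at p. *)
have Z'Y : g Z' Y p = 0.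
  apply/eqP; have := congr1 (fun Z => g Z Y p) dZ'.
  by rewrite gZl g0l evM => /eqP; rewrite mulf_eq0 (negbTE dp).
apply/eqP; move: Z'Y; rewrite /Z' gBl gZl g_suml evB evM ev_sum big1 ?subr0.
  by move/eqP; rewrite mulf_eq0 (negbTE dp).
move=> i _; rewrite gZl evM mxE ev_sum big1 ?mul0r // => j _.
by rewrite evM mxE Zp mul0r.
Qed.

(** E_1, ..., E_m and X are dependent at p, and X has a nonzero coefficient in
the relation because the E_k are orthonormal. *)
Lemma parseval p (E : 'I_m -> vfield M) :
  (forall i j, g (E i) (E j) p = (i == j)%:R) ->
  forall X Y, g X Y p = \sum_k g X (E k) p * g Y (E k) p.
Proof.
move=> Ep X Y.
have [c c0 cE] := @tangent_dim p (fun i : 'I_m.+1 => oapp E X (unlift ord0 i)).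
pose cst (a : R) : Cinf M := a *: (1 : Cinf M).
have cstE a : cst a p = a by rewrite evZ ev1 mulr1.
pose Z := cst (c 0 0) *: X + \sum_i cst (c 0 (lift ord0 i)) *: E i.
have Zp f : Z f p = 0.
  rewrite vevD vevZ cstE vev_sum; under eq_bigr do rewrite vevZ cstE.
  rewrite -[RHS](cE f) big_ord_recl unlift_none /=.
  by congr (_ + _); apply: eq_bigr => i _; rewrite liftK.
have gZ Y' : c 0 0 * g X Y' p + \sum_i c 0 (lift ord0 i) * g (E i) Y' p = 0.
  rewrite -[RHS](null_vector Zp Y') gDl gZl g_suml evD evM cstE ev_sum.
  by congr (_ + _); apply: eq_bigr => i _; rewrite gZl evM cstE.
have cl k : c 0 (lift ord0 k) = - (c 0 0 * g X (E k) p).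
  have /eqP := gZ (E k); rewrite addrC addr_eq0 => /eqP <-.
  rewrite (bigD1 k) //= Ep eqxx mulr1 big1 ?addr0 // => i /negbTE ik.
  by rewrite Ep ik mulr0.
have c00 : c 0 0 != 0.
  apply: contraNneq c0 => c00; apply/eqP/matrixP => i j; rewrite ord1 mxE.
  by have [k ->|->] := unliftP ord0 j; rewrite ?cl c00 ?mul0r ?oppr0.
apply: (mulfI c00); rewrite mulr_sumr; have /eqP := gZ Y.
rewrite addr_eq0 -sumrN => /eqP ->; apply: eq_bigr => k _.
by rewrite cl (Defs.metric_sym g Y) mulrA mulNr opprK.
Qed.

End IntegrableHyperplanes.

(** * Brackets of fields tangent to a leaf *)

Section Leaf.
Context (R : realType) (m k : nat) (M : manifold R m).
Context (W : set 'rV[R]_k) (F : 'rV[R]_k -> M).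
Hypothesis oW : open W.
Hypothesis sF : forall f : Cinf M, smooth_on W (f \o F).
Implicit Types (Z : vfield M) (f : Cinf M) (w : 'rV[R]_k).

Local Notation Dl i f := ('D_(delta_mx 0 i) (f \o F)).

(** Z is F-related to the field u, of which no regularity is assumed. *)
Definition along (Z : vfield M) (u : 'rV[R]_k -> 'rV[R]_k) :=
  forall w f, W w -> Z f (F w) = \sum_i u w 0 i * Dl i f w.

Context (t : 'I_k -> Cinf M).
Let A w : 'M[R]_k := \matrix_(i, j) Dl i (t j) w.
Let d w := \det (A w).
Let b (Z : vfield M) i w := \sum_j Z (t j) (F w) * \adj (A w) j i.

Let smooth_A i j : smooth_on W (fun w => A w i j).
Proof.
by apply: smooth_on_ext oW _ (smooth_on_derive i (sF (t j))) => w _; rewrite mxE.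
Qed.

Let smooth_d : smooth_on W d.
Proof. by move=> n; apply: Ck_det => // i j; exact: smooth_A. Qed.

Let smooth_b Z i : smooth_on W (b Z i).
Proof.
move=> n; apply: Ck_sum => // j _; apply: CkM => //; first exact: sF.
exact: (smooth_adj j i oW smooth_A n).
Qed.

Let bE Z u i w : along Z u -> W w -> b Z i w = d w * u w 0 i.
Proof.
move=> Zu Ww; pose z : 'rV[R]_k := \row_j Z (t j) (F w).
have zE : z = u w *m A w.
  by apply/rowP => j; rewrite !mxE Zu //; apply: eq_bigr => a _; rewrite mxE.
have := congr1 (mulmx^~ (\adj (A w))) zE.
rewrite -mulmxA mul_mx_adj mul_mx_scalar => /rowP /(_ i); rewrite !mxE => <-.
by apply: eq_bigr => j _; rewrite !mxE.
Qed.

(** The coordinates u2 of Z2 are not known to be differentiable, but d u2 is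
smooth by Cramer's rule for the functions t_j.  Differentiating
d (Z2 f o F) = sum_i (d u2_i) D_i(f o F) along Z1 gives first derivatives of
f o F, with coefficients independent of f, plus the Hessian of f o F on (u1,u2). *)
Lemma along_second_derivative Z1 u1 Z2 u2 w0 : W w0 ->
  along Z1 u1 -> along Z2 u2 ->
  exists zeta : 'I_k -> R, forall f,
    d w0 * Z1 (Z2 f) (F w0) = \sum_i zeta i * Dl i f w0
      + d w0 * \sum_l \sum_i u1 w0 0 l * u2 w0 0 i
                 * 'D_(delta_mx 0 l) (Dl i f) w0.
Proof.
move=> Ww Zu1 Zu2.
exists (fun i => \sum_l u1 w0 0 l * ('D_(delta_mx 0 l) (b Z2 i) w0
                   - 'D_(delta_mx 0 l) d w0 * u2 w0 0 i)) => f.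
have der h l : smooth_on W h -> derivable h w0 (delta_mx 0 l).
  by move=> /(_ 1%N) [_ /(_ l) [+ _]]; exact.
have leibniz h1 h2 l : smooth_on W h1 -> smooth_on W h2 ->
    'D_(delta_mx 0 l) (h1 * h2) w0
    = h1 w0 * 'D_(delta_mx 0 l) h2 w0 + h2 w0 * 'D_(delta_mx 0 l) h1 w0.
  by move=> s1 s2; rewrite deriveM //; exact: der.
have dG l : d w0 * Dl l (Z2 f) w0 = \sum_i ('D_(delta_mx 0 l) (b Z2 i) w0 * Dl i f w0
      + b Z2 i w0 * 'D_(delta_mx 0 l) (Dl i f) w0)
      - 'D_(delta_mx 0 l) d w0 * Z2 f (F w0).
  apply/eqP; rewrite -subr_eq opprK -[Z2 f (F w0)]/(((Z2 f : Cinf M) \o F) w0).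
  rewrite [_ * ((_ \o _) _)]mulrC -leibniz //; apply/eqP.
  have -> : 'D_(delta_mx 0 l) (d * ((Z2 f : Cinf M) \o F)) w0
      = 'D_(delta_mx 0 l) (\sum_i (b Z2 i * Dl i f)) w0.
    apply: near_eq_derive; apply: (@filterS _ _ _ W); last exact: open_nbhs_nbhs.
    move=> w Ww'; rewrite fct_sumE /=.
    rewrite -[LHS]/(d w * Z2 f (F w)) (Zu2 _ _ Ww') mulr_sumr.
    by apply: eq_bigr => i _; rewrite !fctE (bE i Zu2 Ww') mulrA.
  have sD i : smooth_on W (Dl i f) by exact: smooth_on_derive.
  rewrite derive_sum => [|i]; last first.
    by apply: derivableM; apply: der.
  apply: eq_bigr => i _; rewrite leibniz //; ring.
rewrite (Zu1 _ _ Ww) mulr_sumr.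
transitivity (\sum_l u1 w0 0 l * (d w0 * Dl l (Z2 f) w0)).
  by apply: eq_bigr => l _; rewrite mulrCA.
under eq_bigr do rewrite dG (Zu2 _ _ Ww) mulr_sumr -sumrB mulr_sumr.
rewrite mulr_sumr; under [in RHS]eq_bigr do rewrite mulr_suml.
rewrite [in X in _ = X + _]exchange_big /= -big_split; apply: eq_bigr => l _.
rewrite mulr_sumr -big_split; apply: eq_bigr => i _ /=.
rewrite (bE i Zu2 Ww); ring.
Qed.

(** The Hessian terms of the two iterated derivatives cancel. *)
Lemma along_bracket Z1 u1 Z2 u2 w0 : W w0 -> d w0 != 0 ->
  along Z1 u1 -> along Z2 u2 ->
  exists v, forall f, bracket Z1 Z2 f (F w0) = param_diff F w0 v f.
Proof.
move=> Ww d0 Zu1 Zu2.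
have [z1 z1E] := along_second_derivative Ww Zu1 Zu2.
have [z2 z2E] := along_second_derivative Ww Zu2 Zu1.
pose v : 'rV[R]_k := \row_i ((d w0)^-1 * (z1 i - z2 i)); exists v => f.
have [_ Df] := C1_differentiable oW (sF f 1%N) Ww.
rewrite -[RHS]/('D_v (f \o F) w0) Df.
apply: (mulfI d0).
rewrite -[LHS]/(d w0 * (Z1 (Z2 f) (F w0) - Z2 (Z1 f) (F w0))) mulrBr z1E z2E.
have -> : \sum_l \sum_i u1 w0 0 l * u2 w0 0 i * 'D_(delta_mx 0 l) (Dl i f) w0
    = \sum_l \sum_i u2 w0 0 l * u1 w0 0 i * 'D_(delta_mx 0 l) (Dl i f) w0.
  rewrite exchange_big; apply: eq_bigr => l _; apply: eq_bigr => i _.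
  by rewrite (schwarz _ _ oW (sF f 2%N) Ww) [u1 _ _ _ * _]mulrC.
rewrite opprD addrACA subrr addr0 -sumrB mulr_sumr; apply: eq_bigr => i _.
by rewrite mxE !mulrA mulfV // mul1r mulrBl.
Qed.

End Leaf.

Section Involutive.
Context (R : realType) (m : nat) (M : manifold R m).
Context (g : riemannian_metric M) (eta : oneform M) (V : vfield M).
Hypothesis m_gt0 : (0 < m)%N.
Hypothesis etaV : metric_dual g eta V.
Hypothesis V_neq0 : nowhere_zero V.
Hypothesis eta_int : kernel_integrable eta.

(** The bracket at p is, as a functional on smooth functions, tangent to the
leaf, hence equal to the tangent vector of some field in ker eta; [null_vector]
turns this equality of functionals into an equality of values of eta. *)
Lemma kernel_involutive (X Y : vfield M) p : eta X = 0 -> eta Y = 0 ->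
  eta (bracket X Y) p = 0.
Proof.
move=> X0 Y0.
have [W [F [[oW _ [_ sF] iF rF] [w0 Ww Fw]]]] := eta_int p.
have alongE Z : eta Z = 0 -> exists u, along W F Z u.
  move=> Z0.
  have H w : exists u : 'rV[R]_m.-1, W w -> forall f,
      Z f (F w) = \sum_i u 0 i * 'D_(delta_mx 0 i) (f \o F) w.
    have [Ww'|nW] := pselect (W w); last by exists 0.
    have : range (param_diff F w) (tangent Z (F w)).
      by rewrite rF //; exists Z => //=; rewrite Z0.
    by move=> [u _ uE]; exists u => _ f; rewrite -(param_diffE f u oW sF Ww') uE.
  by have [u uE] := choice H; exists u => w f Ww'; exact: uE.
have [u1 Xu] := alongE X X0; have [u2 Yu] := alongE Y Y0.
have [v v0|t dt] := @separating_family R (Cinf M) m.-1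
    (fun i f => 'D_(delta_mx 0 i) (f \o F) w0).
  apply: contrapT => H; move/eqP: v0; apply; apply: (iF w0 Ww).
  apply/funext => f; rewrite !(param_diffE f _ oW sF Ww).
  rewrite [RHS]big1 => [|i _]; last by rewrite mxE mul0r.
  by apply: contrapT => /eqP vf; apply: H; exists f.
have [v vE] := along_bracket oW sF Ww dt Xu Yu.
have : range (param_diff F w0) (param_diff F w0 v) by exists v.
rewrite rF // => -[Z /= Z0 ZE].
have ZE' f : (bracket X Y - Z) f p = 0.
  by rewrite vevB -Fw vE -ZE subrr.
have := null_vector m_gt0 etaV V_neq0 eta_int ZE' V.
rewrite gBl evB !(Defs.metric_sym g _ V) -!etaV -Fw Z0 subr0.
by [].
Qed.

End Involutive.

(** * Hermitian and locally conformal Kaehler geometry *)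

Section HermitianAlgebra.
Context (R : realType) (m : nat) (M : manifold R m).
Context (J : endo M) (g : riemannian_metric M).
Context (D : vfield M -> vfield M -> vfield M).
Implicit Types (X Y Z W : vfield M) (f h : Cinf M) (p : M).

Lemma vfieldD X f h : X (f + h) = X f + X h.
Proof.
have [lX _] := asboolP _ (vfieldP X).
by have := lX 1 f h; rewrite !scale1r.
Qed.

Lemma vfield0 X : X 0 = 0.
Proof. by have /eqP := vfieldD X 0 0; rewrite addr0 -subr_eq subrr eq_sym => /eqP. Qed.

Lemma vfieldN X f : X (- f) = - X f.
Proof. by apply/eqP; rewrite -addr_eq0 -vfieldD addNr vfield0. Qed.

Lemma Cinf_ext f h : (forall p, f p = h p) -> f = h.
Proof. by move=> fh; apply/val_inj/funext => p; exact: fh. Qed.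

Lemma Cinf_double_inj f h : f + f = h + h -> f = h.
Proof.
move=> fh; apply: Cinf_ext => p; have := congr1 (fun f : Cinf M => f p) fh.
rewrite !evD; move: (f p) (h p) => a b; lra.
Qed.

Hypothesis hJ : hermitian_structure J g.
Hypothesis hD : levi_civita g D.

Let JJ X : J (J X) = - X. Proof. by have [-> _ _] := hJ. Qed.
Let gJJ X Y : g (J X) (J Y) = g X Y. Proof. by have [_ _ ->] := hJ. Qed.

Lemma gJl X Y : g (J X) Y = - g X (J Y).
Proof. by rewrite -gJJ JJ gNl. Qed.

Let DX X Y Z : X (g Y Z) = g (D X Y) Z + g Y (D X Z).
Proof. by have [_ _ _ _ ->] := hD. Qed.

Let brE X Y : bracket X Y = D X Y - D Y X.
Proof. by have [_ _ _ -> _] := hD. Qed.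

Let DDr X Y Z : D X (Y + Z) = D X Y + D X Z.
Proof. by have [_ -> _ _ _] := hD. Qed.

Let DNr X Y : D X (- Y) = - D X Y.
Proof.
have D0 : D X 0 = 0.
  by have /eqP := DDr X 0 0; rewrite addr0 -subr_eq subrr eq_sym => /eqP.
by apply/eqP; rewrite -addr_eq0 -DDr addNr D0.
Qed.

Let DZl h X Y Z : D (h *: X + Y) Z = h *: D X Z + D Y Z.
Proof. by have [-> _ _ _ _] := hD. Qed.

(** g((nabla_X J) Y, Z), with J moved to the other side in the second term. *)
Definition nablaJ X Y Z : Cinf M := g (D X (J Y)) Z + g (D X Y) (J Z).

(** Differentiate g(JY,Z) = - g(Y,JZ) along X. *)
Lemma nablaJ_skew X Y Z : nablaJ X Y Z = - nablaJ X Z Y.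
Proof.
have /eqP := vfieldN X (g Y (J Z)).
rewrite -gJl !DX -subr_eq0 opprK => /eqP E.
apply/eqP; rewrite -addr_eq0 -E /nablaJ; apply/eqP.
rewrite (Defs.metric_sym g Y) (Defs.metric_sym g (J Y)); ring.
Qed.

(** Differentiate J^2 = - 1. *)
Lemma nablaJ_J X Y Z : nablaJ X (J Y) Z = nablaJ X Y (J Z).
Proof. by rewrite /nablaJ !JJ DNr gNl gNr addrC. Qed.

Lemma nablaJNr X Y Z : nablaJ X Y (- Z) = - nablaJ X Y Z.
Proof. by rewrite /nablaJ linearN !gNr opprD. Qed.

(** Expand the brackets of the Nijenhuis tensor with the torsion-free
connection. *)
Lemma nablaJ_nijenhuis X Y Z :
  nablaJ (J X) Y Z + nablaJ X Y (J Z) = nablaJ (J Y) X Z + nablaJ Y X (J Z).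
Proof.
have [_ /(_ X Y) N _] := hJ.
have := congr1 (fun W => g W Z) N.
rewrite /nijenhuis !brE !linearB /= !JJ g0l !(gDl, gNl) !gJl => E.
by apply/eqP; rewrite -subr_eq0 -E /nablaJ !JJ !gNr; apply/eqP; ring.
Qed.

(** The difference of the two sides is symmetric in its first two arguments and
skew in the last two, so six transpositions bring it back to its opposite. *)
Lemma nablaJ_Jl X Y Z : nablaJ (J X) Y Z = - nablaJ X Y (J Z).
Proof.
pose B X Y Z := nablaJ (J X) Y Z + nablaJ X Y (J Z).
have Bsym a b c : B a b c = B b a c by exact: nablaJ_nijenhuis.
have Bskew a b c : B a b c = - B a c b.
  rewrite /B opprD -nablaJ_skew; congr (_ + _).
  by rewrite -nablaJ_J nablaJ_skew.
(* (XY)(YZ)(XY)(YZ)(XY)(YZ) is the identity and uses three skew exchanges. *)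
have B2 : B X Y Z = - B X Y Z.
  by rewrite {1}Bsym Bskew Bsym Bskew opprK Bsym Bskew.
apply/eqP; rewrite -addr_eq0; apply/eqP/Cinf_double_inj.
by rewrite addr0 {1}[X in X + _]B2 addNr.
Qed.

Lemma d_fundamental_form X Y Z : ext_d2 (fundamental_form J g) X Y Z
  = - (nablaJ X Y Z + nablaJ Y Z X + nablaJ Z X Y).
Proof.
transitivity (nablaJ X Z Y + nablaJ Y X Z + nablaJ Z Y X); last first.
  rewrite (nablaJ_skew X Z) (nablaJ_skew Y X) (nablaJ_skew Z Y); ring.
rewrite /ext_d2 /fundamental_form /nablaJ !DX !brE.
rewrite !gBl (Defs.metric_sym g Y (D X _)) (Defs.metric_sym g Z (D Y _)).
rewrite (Defs.metric_sym g X (D Z _)); ring.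
Qed.

Context (eta theta : oneform M) (U V : vfield M).
Hypothesis hLee : lee_form J eta theta.
Hypothesis hlck : lck J g theta.
Hypothesis thetaU : metric_dual g theta U.
Hypothesis etaV : metric_dual g eta V.

Lemma theta_J X : theta (J X) = - eta X.
Proof. by rewrite hLee JJ linearN. Qed.

(** V - JU is orthogonal to everything, hence zero as a derivation. *)
Lemma VE : V = J U.
Proof.
apply/eqP; rewrite -subr_eq0; apply/eqP/vfield_ext => f p.
have E X : g (V - J U) X = 0.
  by rewrite gBl -etaV gJl opprK -thetaU theta_J subrr.
have /metric_eq0 T0 : g (V - J U) (V - J U) p = 0 by rewrite E.
exact: (congr1 (fun t : Cinf M -> R => t f) T0).
Qed.

(** The cyclic sum of A over (X,Y,Z) is - d Omega(X,Y,Z).  Replacing (Y,Z) by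
(JY,JZ) changes the sign of A(X,Y,Z) and preserves the two other terms, so
subtracting isolates A(X,Y,Z). *)
Lemma nablaJ_lck X Y Z : nablaJ X Y Z + nablaJ X Y Z
  = eta Z * g X Y - eta Y * g X Z - theta Y * g Z (J X) - theta Z * g X (J Y).
Proof.
have [hO _] := hlck.
have E1 := hO X Y Z; rewrite d_fundamental_form in E1.
have E2 := hO X (J Y) (J Z); rewrite d_fundamental_form in E2.
rewrite nablaJ_J JJ nablaJNr (nablaJ_Jl Y) nablaJ_J JJ nablaJNr opprK in E2.
rewrite (nablaJ_Jl Z) JJ nablaJNr opprK in E2.
transitivity (wedge12 theta (fundamental_form J g) X (J Y) (J Z)
              - wedge12 theta (fundamental_form J g) X Y Z).
  by rewrite -E1 -E2; ring.
rewrite /wedge12 /fundamental_form !JJ !theta_J !gNr !gJJ.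
rewrite gJl (Defs.metric_sym g Z X); ring.
Qed.

Definition hessU X Y : Cinf M := g (D X U) Y.

(** This is closedness of theta. *)
Lemma hessU_sym X Y : hessU X Y = hessU Y X.
Proof.
have [_ /(_ X Y)] := hlck; rewrite /ext_d1 !thetaU !DX brE gBr /hessU => E.
by apply/eqP; rewrite -subr_eq0 -E; apply/eqP; ring.
Qed.

(** eta = - theta o J, so the covariant derivative of eta is - S(X,JY) - A(X,Y,U). *)
Lemma d_eta X Y : ext_d1 eta X Y
  = hessU Y (J X) - hessU X (J Y) - wedge11 eta theta X Y + g U U * g X (J Y).
Proof.
have etaE Z : eta Z = - g U (J Z) by rewrite -thetaU theta_J opprK.
have E : ext_d1 eta X Y
    = hessU Y (J X) - hessU X (J Y) - nablaJ X Y U + nablaJ Y X U.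
  rewrite /ext_d1 !etaE !vfieldN !DX brE linearB /= gBr /nablaJ /hessU.
  have gUJ W : g U (J W) = - g W (J U) by rewrite (Defs.metric_sym g U) gJl.
  by rewrite !gUJ !(Defs.metric_sym g U (D _ _)); ring.
have EX := nablaJ_lck X Y U; have EY := nablaJ_lck Y X U.
apply: Cinf_double_inj; rewrite E.
transitivity (hessU Y (J X) - hessU X (J Y) + (hessU Y (J X) - hessU X (J Y))
   - (nablaJ X Y U + nablaJ X Y U) + (nablaJ Y X U + nablaJ Y X U)); first by ring.
rewrite EX EY /wedge11 -!(Defs.metric_sym g U) -!thetaU !theta_J !thetaU.
rewrite (Defs.metric_sym g Y (J X)) gJl (Defs.metric_sym g Y X).
ring.
Qed.



Lemma hessUZl h X Y : hessU (h *: X) Y = h * hessU X Y.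
Proof.
have D0 : D 0 U = 0.
  have /eqP := DZl 1 0 0 U.
  by rewrite !scale1r addr0 -subr_eq subrr eq_sym => /eqP.
by rewrite /hessU -[h *: X]addr0 DZl D0 addr0 gZl.
Qed.

Lemma hessUDl X Z Y : hessU (X + Z) Y = hessU X Y + hessU Z Y.
Proof. by rewrite /hessU -{1}[X]scale1r DZl scale1r gDl. Qed.

Let JD X Y : J (X + Y) = J X + J Y. Proof. exact: linearD. Qed.
Let JZ h X : J (h *: X) = h *: J X. Proof. exact: linearZ. Qed.
Let etaD X Y : eta (X + Y) = eta X + eta Y. Proof. exact: linearD. Qed.
Let thetaD X Y : theta (X + Y) = theta X + theta Y. Proof. exact: linearD. Qed.

Lemma d_etaDl X Z Y : ext_d1 eta (X + Z) Y = ext_d1 eta X Y + ext_d1 eta Z Y.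
Proof.
rewrite !d_eta /wedge11 JD etaD thetaD hessUDl (hessU_sym Y) hessUDl.
rewrite -!(hessU_sym Y) gDl; ring.
Qed.

Lemma d_etaZl h X Y : ext_d1 eta (h *: X) Y = h * ext_d1 eta X Y.
Proof.
rewrite !d_eta /wedge11 JZ !oneformZ hessUZl (hessU_sym Y) hessUZl.
rewrite -!(hessU_sym Y) gZl; ring.
Qed.

Lemma d_eta_sym X Y : ext_d1 eta X Y = - ext_d1 eta Y X.
Proof.
rewrite !d_eta /wedge11 (Defs.metric_sym g Y) gJl; ring.
Qed.

Lemma d_eta_J X Y : ext_d1 eta (J X) (J Y) = ext_d1 eta X Y.
Proof.
have hessUNr A B : hessU A (- B) = - hessU A B by rewrite /hessU gNr.
rewrite !d_eta /wedge11 !JJ !theta_J -!hLee !hessUNr gNr gJl.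
rewrite (hessU_sym (J Y)) (hessU_sym (J X)); ring.
Qed.

Lemma g_XJX X : g X (J X) = 0.
Proof.
apply: Cinf_double_inj; rewrite addr0 -{2}[g X (J X)]opprK -gJl.
by rewrite (Defs.metric_sym g (J X)) subrr.
Qed.

Lemma eta_U : eta U = 0.
Proof. by rewrite etaV VE (Defs.metric_sym g) g_XJX. Qed.

Lemma theta_V : theta V = 0.
Proof. by rewrite thetaU VE g_XJX. Qed.

Lemma theta_U : theta U = g U U. Proof. exact: thetaU. Qed.

Lemma eta_V : eta V = g U U. Proof. by rewrite etaV VE gJJ. Qed.

Lemma JV : J V = - U. Proof. by rewrite VE JJ. Qed.

Hypothesis d_eta_ker : forall X Y, eta X = 0 -> eta Y = 0 ->
  ext_d1 eta X Y = 0.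

(** Multiplying by |U|^2 twice keeps the orthogonal decomposition of X and Y
along U, V and their complement inside the module of smooth fields. *)
Lemma d_eta_wedge X Y : g U U * g U U * ext_d1 eta X Y
  = ext_d1 eta V U * wedge11 eta theta X Y.
Proof.
pose N := g U U; pose H Z := N *: Z - eta Z *: V - theta Z *: U.
have HE Z : N *: Z = H Z + (eta Z *: V + theta Z *: U).
  by rewrite /H addrACA subrK addNr addr0.
have etaH Z : eta (H Z) = 0.
  rewrite /H !etaD !linearN /= !oneformZ eta_V eta_U -/N; ring.
have thetaH Z : theta (H Z) = 0.
  rewrite /H !thetaD !linearN /= !oneformZ theta_V theta_U -/N; ring.
clearbody H.
have HU Z : ext_d1 eta (H Z) U = 0 by apply: d_eta_ker; rewrite ?etaH ?eta_U.
(* J exchanges the lines of U and V and preserves their complement. *)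
have HV Z : ext_d1 eta (H Z) V = 0.
  rewrite -d_eta_J JV d_eta_sym -[- U]scaleN1r d_etaZl d_eta_ker ?eta_U //.
    by rewrite mulr0 oppr0.
  by rewrite -hLee thetaH.
have HY Z : ext_d1 eta (H Z) (N *: Y) = 0.
  rewrite d_eta_sym (HE Y) !d_etaDl !d_etaZl.
  rewrite (d_eta_sym V) (d_eta_sym U) HU HV.
  rewrite (d_eta_ker (etaH Y) (etaH Z)); ring.
have E1 Z : N * ext_d1 eta Z (N *: Y)
    = eta Z * ext_d1 eta V (N *: Y) + theta Z * ext_d1 eta U (N *: Y).
  by rewrite -d_etaZl HE !d_etaDl !d_etaZl HY add0r.
have NY Z : ext_d1 eta Z (N *: Y) = N * ext_d1 eta Z Y.
  by rewrite d_eta_sym d_etaZl d_eta_sym mulrN opprK.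
have E2 Z : ext_d1 eta (H Y) Z = 0 ->
    N * ext_d1 eta Z Y = eta Y * ext_d1 eta Z V + theta Y * ext_d1 eta Z U.
  move=> HZ; rewrite -NY d_eta_sym HE !d_etaDl !d_etaZl HZ.
  rewrite (d_eta_sym V) (d_eta_sym U); ring.
have dVV Z : ext_d1 eta Z Z = 0.
  apply: Cinf_double_inj; by rewrite {1}d_eta_sym addNr addr0.
have := E1 X; rewrite !NY mulrA => ->.
rewrite (E2 V (HV Y)) (E2 U (HU Y)) !dVV (d_eta_sym U V) /wedge11; ring.
Qed.

(** g(nabla_U V, Z) = - S(U,JZ) because (nabla_U J)U = 0, and g(nabla_V U, Z) =
S(Z,V) is expressed through d eta(U,Z); the two terms S(U,JZ) add up to
g(G,JZ). *)
Lemma bracket_UV G Z : gradient g (g U U) G ->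
  g (bracket U V) Z + g G (J Z) + ext_d1 eta U Z = 0.
Proof.
move=> gradG.
have HU W : hessU U W + hessU U W = g G W.
  by rewrite !(hessU_sym U W) gradG DX (Defs.metric_sym g U (D _ _)).
have nUU : nablaJ U U Z = 0.
  apply: Cinf_double_inj; rewrite nablaJ_lck eta_U g_XJX theta_U.
  rewrite etaV VE (Defs.metric_sym g (J U)); ring.
rewrite brE gBl -[g (D V U) Z]/(hessU V Z) (hessU_sym V).
have -> : g (D U V) Z = - hessU U (J Z).
  by rewrite VE; apply/eqP; rewrite -addr_eq0 -[X in _ == X]nUU.
rewrite -(HU (J Z)) d_eta /wedge11 eta_U theta_U -VE -(thetaU (J Z)) theta_J; ring.
Qed.

Lemma codiff1E p : codiff1 g D theta p
  = - \sum_k hessU (frame g p k) (frame g p k) p.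
Proof.
rewrite /codiff1; congr (- _); apply: eq_bigr => k _ /=.
by rewrite !thetaU DX /hessU addrK.
Qed.

(** The traces of S over E_k and over J E_k coincide, because J is an isometry. *)
Lemma d_eta_trace p (E : 'I_m -> vfield M) :
  (forall i j, g (E i) (E j) p = (i == j)%:R) ->
  (forall X Y, g X Y p = \sum_k g X (E k) p * g Y (E k) p) ->
  \sum_k ext_d1 eta (E k) (J (E k)) p
  = 2 * \sum_k hessU (E k) (E k) p + (2 - m%:R) * g U U p.
Proof.
move=> Eon pars.
have trJ : \sum_k hessU (J (E k)) (J (E k)) p = \sum_k hessU (E k) (E k) p.
  transitivity (\sum_k \sum_j hessU (E j) (J (E k)) p * g (J (E k)) (E j) p).
    apply: eq_bigr => k _; rewrite /hessU pars; apply: eq_bigr => j _.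
    by congr (_ * _); exact: (congr1 (fun f : Cinf M => f p) (hessU_sym _ _)).
  rewrite exchange_big; apply: eq_bigr => j _ /=.
  rewrite /hessU -gJJ pars; apply: eq_bigr => k _.
  rewrite (gJl (D _ _)) (gJl (E k)) (Defs.metric_sym g (E k) (J _)) !evN.
  by rewrite mulrN mulNr.
have wed k : wedge11 eta theta (E k) (J (E k)) p
    = - (g V (E k) p * g V (E k) p) - g U (E k) p * g U (E k) p.
  rewrite /wedge11 theta_J -hLee !thetaU !etaV evB !evM evN; ring.
have step k : ext_d1 eta (E k) (J (E k)) p
   = hessU (J (E k)) (J (E k)) p + hessU (E k) (E k) p
     + (g V (E k) p * g V (E k) p + g U (E k) p * g U (E k) p) - g U U p.
  rewrite d_eta JJ /hessU !gNr -[LHS]/(g (D (J (E k)) U) (J (E k)) p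
    - - g (D (E k) U) (E k) p - wedge11 eta theta (E k) (J (E k)) p
    + g U U p * - g (E k) (E k) p).
  have En : g (E k) (E k) p = 1 by rewrite Eon eqxx.
  rewrite wed En; ring.
rewrite (eq_bigr _ (fun k _ => step k)) sumrB !big_split /= trJ -!pars.
rewrite sumr_const card_ord VE gJJ -mulr_natr; ring.
Qed.

End HermitianAlgebra.

(** * The structure equations *)

(** Without an orthonormal family near p the frame at p is the zero family; the
codifferential of Omega at p is then 0, and so is eta at p. *)
Lemma frame_orthonormal (R : realType) (n m : nat) (M : manifold R m)
  (J : endo M) (g : riemannian_metric M) (D : vfield M -> vfield M -> vfield M)
  (eta : oneform M) (V : vfield M) (p : M) :
  levi_civita g D -> anti_lee_form n J g D eta -> eta V p != 0 ->
  orthonormal_near g p (frame g p).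
Proof.
move=> [DZl _ _ _ _] aL etaV.
have D00 : D 0 0 = 0.
  have /eqP := DZl 1 0 0 0.
  by rewrite !scale1r addr0 -subr_eq subrr eq_sym => /eqP.
have [[E onE]|noE] := pselect (exists E, orthonormal_near g p E).
  exact: (xgetPex (fun=> 0) (ex_intro _ E onE)).
have E0 : frame g p = fun=> 0.
  by apply: xgetPN => E onE; apply: noE; exists E.
move: etaV; rewrite aL /codiff2 E0 big1 ?oppr0 ?mulr0 ?eqxx // => i _ /=.
by rewrite /fundamental_form D00 !g0l !subr0.
Qed.

Local Close Scope classical_set_scope.
Unset Implicit Arguments.

Theorem theorem3p4 (R : realType) (n : nat) (M : manifold R (2 * n + 2)%N)
  (J : endo M) (g : riemannian_metric M) (D : vfield M -> vfield M -> vfield M)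
  (eta theta : oneform M) (U V G : vfield M) :
  (1 <= n)%N ->
  hermitian_structure J g ->
  levi_civita g D ->
  anti_lee_form n J g D eta ->
  lee_form J eta theta ->
  lck J g theta ->
  metric_dual g theta U ->
  metric_dual g eta V ->
  nowhere_zero V ->
  kernel_integrable eta ->
  gradient g (g U U) G ->
  (forall (X Y : vfield M) (p : M),
     ext_d1 eta X Y p
     = (codiff1 g D theta p / g U U p + n%:R) * wedge11 eta theta X Y p) /\
  (forall p : M,
     tangent (bracket U V) p
     = (codiff1 g D theta p + n%:R * g U U p) *: tangent V p
       + tangent (J G) p).
Proof.
move=> _ hJ hD aL hLee hlck thetaU etaV V0 eta_int gradG.
have m0 : (0 < 2 * n + 2)%N by rewrite addn2.
have ker X Y : eta X = 0 -> eta Y = 0 -> ext_d1 eta X Y = 0.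
  move=> X0 Y0; apply: Cinf_ext => p.
  rewrite /ext_d1 X0 Y0 !vfield0 subr0 sub0r evN.
  by rewrite (kernel_involutive m0 etaV V0 eta_int) // oppr0.
have N0 p : g U U p != 0.
  rewrite -(eta_V hJ hLee thetaU etaV); exact: (etaVV_neq0 etaV V0).
have wedgeE := d_eta_wedge hJ hD hLee hlck thetaU etaV ker.
(* The trace of N^2 d eta = d eta(V,U) eta /\ theta determines d eta(V,U); the
   trace of eta /\ theta is - 2 N, with N = |theta|^2. *)
have dVU p : ext_d1 eta V U p
    = g U U p * (codiff1 g D theta p + n%:R * g U U p).
  have on := nbhs_singleton (frame_orthonormal hD aL (etaVV_neq0 etaV V0 p)).
  have pars := parseval m0 etaV V0 eta_int on.
  have tr := d_eta_trace hJ hD hLee hlck thetaU etaV on pars.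
  have := codiff1E hD thetaU p.
  move: on pars tr; set E := frame g p => on pars tr cod.
  have wk k : g U U p * g U U p * ext_d1 eta (E k) (J (E k)) p
      = ext_d1 eta V U p * - (g V (E k) p * g V (E k) p
                              + g U (E k) p * g U (E k) p).
    have := congr1 (fun f : Cinf M => f p) (wedgeE (E k) (J (E k))).
    rewrite /wedge11 (theta_J hJ hLee) -hLee !thetaU !etaV => H.
    apply: (etrans H); rewrite -[LHS]/(ext_d1 eta V U p *
      (g V (E k) p * - g V (E k) p - g U (E k) p * g U (E k) p)); ring.
  have : g U U p * g U U p * \sum_k ext_d1 eta (E k) (J (E k)) p
      = ext_d1 eta V U p * - (g U U p + g U U p).
    rewrite mulr_sumr (eq_bigr _ (fun k _ => wk k)) -mulr_sumr sumrN big_split /=.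
    by rewrite -!pars (VE hJ hLee thetaU etaV); have [_ _ ->] := hJ.
  rewrite tr; move: cod (N0 p); rewrite natrD natrM.
  move: (\sum_k _) (codiff1 _ _ _ _) (ext_d1 _ _ _ _) (g U U p) => s d c N -> N1 H.
  apply: (mulfI N1); apply: (@mulfI _ 2) => //.
  rewrite -[LHS]opprK (_ : - (2 * (N * c)) = c * - (N + N)); last by ring.
  by rewrite -H; ring.
have first X Y p : ext_d1 eta X Y p
     = (codiff1 g D theta p / g U U p + n%:R) * wedge11 eta theta X Y p.
  have H := congr1 (fun f : Cinf M => f p) (wedgeE X Y).
  have {}H : g U U p * g U U p * ext_d1 eta X Y p
    = ext_d1 eta V U p * wedge11 eta theta X Y p by exact: H.
  apply: (mulfI (mulf_neq0 (N0 p) (N0 p))); rewrite H dVU.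
  move: (codiff1 _ _ _ _) (wedge11 _ _ _ _ _) (N0 p) => d w; by move=> N1; field.
split=> // p.
pose c : Cinf M := (codiff1 g D theta p + n%:R * g U U p) *: (1 : Cinf M).
have cE : c p = codiff1 g D theta p + n%:R * g U U p by rewrite evZ ev1 mulr1.
pose W := bracket U V - c *: V - J G.
(* W is g-null at p, hence zero as a tangent vector there. *)
have W0 Z : g W Z p = 0.
  have H := congr1 (fun f : Cinf M => f p)
    (bracket_UV hJ hD hLee hlck thetaU etaV Z gradG).
  have {}H : g (bracket U V) Z p + g G (J Z) p + ext_d1 eta U Z p = 0 by exact: H.
  have dUZ : ext_d1 eta U Z p = - (c p * g V Z p).
    rewrite first cE /wedge11 (eta_U hJ hLee thetaU etaV) (thetaU U) -(etaV Z).
    rewrite -[X in _ * X]/(0 * theta Z p - eta Z p * g U U p).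
    by field; exact: N0.
  rewrite dUZ in H.
  rewrite /W !gBl gZl (gJl hJ).
  rewrite -[LHS]/(g (bracket U V) Z p - c p * g V Z p - - g G (J Z) p).
  by rewrite -[RHS]H; ring.
have /metric_eq0 TW := W0 W.
apply/funext => f.
have := congr1 (fun t : Cinf M -> R => t f) TW.
rewrite -[X in X = _ -> _]/(bracket U V f p - c p * V f p - J G f p) cE => H.
apply/eqP; rewrite -subr_eq0; apply/eqP; rewrite -[RHS]H.
rewrite -[LHS]/(bracket U V f p
  - ((codiff1 g D theta p + n%:R * g U U p) * V f p + J G f p)).
by rewrite opprD addrA.
Qed.
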